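(* Let $F$ be monotone and $\ell$-star-cocoercive, let $\mathcal{C}\subset\mathbb{R}^d$ be a compact convex set with $X^*\subset\mathcal{C}$ and diameter $\Omega_{\mathcal{C}}=\max_{x,y\in\mathcal{C}}\|x-y\|$, and let the expected cocoercivity assumption hold, i.e. for all $x\in\mathbb{R}^d$, with $x^*=\mathrm{proj}_{X^*}(x)$, $$\mathbb{E}_{\xi\sim\mathcal{D}}\|F_\xi(x)-F_\xi(x^* )\|^2\le\ell_{\mathcal{D}}\langle F(x)-F(x^* ),x-x^*\rangle.$$ Assume that $0<\gamma\le\frac1{2\ell_{\mathcal{D}}}$. Then for all $K\ge1$ the iterates produced by SGDA-AS satisfy $$\begin{aligned}\mathbb{E}\left[\mathrm{Gap}_{\mathcal{C}}\left(\frac1K\sum_{k=1}^Kx^k\right)\right]\le\ &\frac{3\max_{u\in\mathcal{C}}\|x^0-u\|^2}{2\gamma K}+\frac{8\gamma\ell^2\Omega_{\mathcal{C}}^2}{K}+\frac{(4\ell_{\mathcal{D}}+\ell)\|x^0-x^{*,0}\|^2}{K}\\&+2\gamma\big(2+\gamma(4\ell_{\mathcal{D}}+\ell)\big)\sigma_*^2+9\gamma\max_{x^*\in X^*}\|F(x^* )\|^2,\end{aligned}$$ where $\sigma_*^2=\max_{x^*\in X^*}\mathbb{E}_{\xi\sim\mathcal{D}}\|F_\xi(x^* )-F(x^* )\|^2$.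
   Context: Norms and inner products on $\mathbb{R}^d$ are Euclidean. $F:\mathbb{R}^d\to\mathbb{R}^d$ is an operator with $F(x)=\mathbb{E}_{\xi\sim\mathcal{D}}[F_\xi(x)]$ for all $x$, where $\mathcal{D}$ is a distribution; $R:\mathbb{R}^d\to\mathbb{R}\cup\{+\infty\}$ is a proper lower semicontinuous convex function. $X^*$ is the (nonempty) set of solutions of the regularized variational inequality: find $x^*\in\mathbb{R}^d$ with $\langle F(x^* ),x-x^*\rangle+R(x)-R(x^* )\ge0$ for all $x\in\mathbb{R}^d$. $\mathrm{proj}_{X^*}(x)=\arg\min_{y\in X^*}\|y-x\|$ (taken to be well defined), and $x^{*,k}=\mathrm{proj}_{X^*}(x^k)$. The quantity $\sigma_*^2$ is finite. $F$ is monotone if $\langle F(x)-F(y),x-y\rangle\ge0$ for all $x,y$. $F$ is $\ell$-star-cocoercive ($\ell>0$) if $\|F(x)-F(x^* )\|^2\le\ell\langle F(x)-F(x^* ),x-x^*\rangle$ for all $x$, where $x^*=\mathrm{proj}_{X^*}(x)$. Restricted gap function: $\mathrm{Gap}_{\mathcal{C}}(z)=\max_{u\in\mathcal{C}}[\langle F(u),z-u\rangle+R(z)-R(u)]$ (maximum understood as supremum). SGDA-AS: from a deterministic $x^0\in\mathbb{R}^d$, at each iteration sample $\xi^k\sim\mathcal{D}$ independently of previous iterations, set $g^k=F_{\xi^k}(x^k)$ and $x^{k+1}=\mathrm{prox}_{\gamma R}(x^k-\gamma g^k)$, where $\mathrm{prox}_{\gamma R}(x)=\arg\min_{y}\{R(y)+\|y-x\|^2/(2\gamma)\}$.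 *)

(* Defs.v *)
From HB Require Import structures.
From mathcomp Require Export all_boot all_order all_algebra.
From mathcomp Require Export all_classical all_reals all_analysis.

Set Implicit Arguments.
Unset Strict Implicit.
Unset Printing Implicit Defensive.

Import Order.TTheory GRing.Theory Num.Theory.
Import numFieldNormedType.Exports.

Local Open Scope classical_set_scope.
Local Open Scope ring_scope.

(* The norm that mathcomp-analysis puts on matrices is the sup norm, so the
   Euclidean structure of R^d = 'rV[R]_d is introduced here.  The topology of
   'rV[R]_d (used for compactness and semicontinuity) is the usual one. *)
Section Euclidean.
Context {R : realType} {d : nat}.
Implicit Types u v : 'rV[R]_d.

Definition dot u v : R := \sum_(i < d) u 0 i * v 0 i.

Definition enorm u : R := Num.sqrt (dot u u).

End Euclidean.

Definition borel_rV (R : realType) (d : nat) :=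
  g_sigma_algebraType [set A : set 'rV[R]_d | open A].

Section ConvexAnalysis.
Context {R : realType} {d : nat}.
Local Notation V := 'rV[R]_d.
Implicit Types (A C : set V) (f r : V -> \bar R) (x y z : V).

Definition proper_fun r : Prop :=
  (forall x, r x != -oo%E) /\ (exists x, r x \is a fin_num).

Definition econvex_fun r : Prop :=
  forall x y (t : R), 0 <= t <= 1 ->
    (r (t *: x + (1 - t) *: y)%R <= t%:E * r x + (1 - t)%:E * r y)%E.

Definition minimizers A f : set V :=
  [set y | A y /\ forall z, A z -> (f y <= f z)%E].

(* Arbitrary value when there is no minimizer. *)
Definition argmin A f : V := xget 0 (minimizers A f).

Definition dist_to x : V -> \bar R := fun y => (enorm (y - x))%:E.

Definition proj A x : V := argmin A (dist_to x).

Definition proj_well_defined A : Prop :=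
  forall x, exists! y, minimizers A (dist_to x) y.

Definition prox (gamma : R) r x : V :=
  argmin setT (fun y => r y + (enorm (y - x) ^+ 2 / (2 * gamma))%:E)%E.

End ConvexAnalysis.

Section VariationalInequality.
Context {R : realType} {d : nat}.
Local Notation V := 'rV[R]_d.
Implicit Types (F : V -> V) (r : V -> \bar R) (C X : set V).

(* In \bar R, +oo - +oo = -oo; since r is proper, a solution x therefore has
   r x finite. *)
Definition VI_solutions F r : set V :=
  [set x | forall y, (0 <= (dot (F x) (y - x)%R)%:E + r y - r x)%E].

Definition monotone_op F : Prop :=
  forall x y, 0 <= dot (F x - F y) (x - y).

Definition star_cocoercive X F (ell : R) : Prop :=
  forall x, enorm (F x - F (proj X x)) ^+ 2
              <= ell * dot (F x - F (proj X x)) (x - proj X x).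

(* The convention +oo - +oo = -oo makes the points u with r u = +oo irrelevant
   in the supremum. *)
Definition Gap F r C (z : V) : \bar R :=
  ereal_sup [set ((dot (F u) (z - u)%R)%:E + r z - r u)%E | u in C].

Definition diameter C : \bar R :=
  ereal_sup [set (enorm (p.1 - p.2))%:E | p in C `*` C].

End VariationalInequality.

Section Stochastic.
Context {R : realType} {d : nat} {dXi : measure_display}
  {Xi : measurableType dXi}.
Local Notation V := 'rV[R]_d.
Implicit Types (D : probability Xi R) (Fxi : Xi -> V -> V) (F : V -> V).

(* Joint measurability of (xi, x) |-> F_xi(x), which makes the iterates below
   random vectors. *)
Definition measurable_oracle Fxi : Prop :=
  forall i : 'I_d,
    measurable_fun [set: Xi * borel_rV R d] (fun p => Fxi p.1 p.2 0 i).

(* F(x) = E_{xi ~ D}[F_xi(x)], coordinatewise *)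
Definition unbiased_oracle D Fxi F : Prop :=
  forall x (i : 'I_d),
    D.-integrable [set: Xi] (fun xi => (Fxi xi x 0 i)%:E) /\
    ('E_D[(fun xi => Fxi xi x 0 i)%R] = (F x 0 i)%:E)%E.

Definition expected_cocoercive D Fxi F (X : set V) (ellD : R) : Prop :=
  forall x,
    ('E_D[(fun xi => enorm (Fxi xi x - Fxi xi (proj X x)) ^+ 2)%R]
      <= (ellD * dot (F x - F (proj X x)) (x - proj X x))%:E)%E.

Definition sigma_star2 D Fxi F (X : set V) : \bar R :=
  ereal_sup [set 'E_D[(fun xi => enorm (Fxi xi x - F x) ^+ 2)%R]%E | x in X].

Context {dO : measure_display} {Om : measurableType dO}.
Implicit Type P : probability Om R.

Definition mutually_independent P (xi : nat -> Om -> Xi) : Prop :=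
  forall (s : seq nat) (A : nat -> set Xi), uniq s ->
    (forall k, measurable (A k)) ->
    P (\bigcap_(k in [set` s]) (xi k @^-1` A k))
      = (\prod_(k <- s) P (xi k @^-1` A k))%E.

(* The probability space Om carries the samples xi^0, xi^1, ... *)
Definition iid_samples P D (xi : nat -> {RV P >-> Xi}) : Prop :=
  (forall k (A : set Xi), measurable A -> distribution P (xi k) A = D A) /\
  mutually_independent P xi.

Fixpoint sgda (r : V -> \bar R) Fxi (gamma : R) (x0 : V)
    (xi : nat -> Om -> Xi) (k : nat) (w : Om) : V :=
  if k is k'.+1 then
    let xk := sgda r Fxi gamma x0 xi k' w in
    prox gamma r (xk - gamma *: Fxi (xi k' w) xk)
  else x0.

End Stochastic.

(* Main.v *)
From mathcomp Require Import ring lra measurable_realfun.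
Require Import Defs.

(** Besides the iterates x_k, follow the ghost sequence
      y_0 = x_0,  y_(k+1) = y_k - gamma M_k,  M_k = F(x_k) - F_(xi_k)(x_k),
    and, writing p for the projection onto X*, lam = 6 gamma ell_D and u for a
    point of C, the energy
      2 gamma sum_(j <= k) [<F(u), x_j - u> + R(x_j) - R(u)]
        - 2 gamma <F(u), x_k - x_0>
        + |x_k - u|^2 + |y_k - u|^2 + lam |x_k - p(x_k)|^2.
    Monotonicity of F, the prox inequality at u and at p(x_k), and the
    variational inequality at p(x_k) bound its increase at step k by a quantity
    H(xi_k, x_k, y_k) that does not depend on u; the ghost sequence is what
    makes the noise term <M_k, x_k - y_k> independent of u.  For fixed (x, y),
    unbiasedness and expected cocoercivity bound the mean of H(., x, y) by a
    constant b, the choice of lam absorbing the term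
    <F(x) - F(p(x)), x - p(x)>.  With
      t_k = 3 D^2 + lam |x_0 - p(x_0)|^2 + 4 gamma^2 ell^2 diam^2
            + 4 gamma^2 Phi + sum_(j < k) H(xi_j, x_j, y_j),
    where D bounds |x_0 - u| on C and Phi bounds |F|^2 on X*, the gap of the
    average iterate is at most t_K / (2 gamma K).  Taking u in X* shows that
    t_k >= 0 along every sample path, so that E[t_(k+1)] <= E[t_k] + b follows
    from Tonelli's theorem for nonnegative functions, without any integrability
    of the iterates. *)

Set Implicit Arguments.
Unset Strict Implicit.
Unset Printing Implicit Defensive.

Import Order.TTheory GRing.Theory Num.Theory.
Import numFieldNormedType.Exports.

Local Open Scope classical_set_scope.
Local Open Scope ring_scope.

(** * Euclidean geometry of row vectors *)

Section EuclideanTheory.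
Context {R : realType} {d : nat}.
Local Notation V := 'rV[R]_d.
Implicit Types u v w : V.

Lemma dotC u v : dot u v = dot v u.
Proof. by apply: eq_bigr => i _; rewrite mulrC. Qed.

Lemma dotDl u v w : dot (u + v) w = dot u w + dot v w.
Proof. by rewrite -big_split; apply: eq_bigr => i _; rewrite mxE mulrDl. Qed.

Lemma dotNl u v : dot (- u) v = - dot u v.
Proof. by rewrite -sumrN; apply: eq_bigr => i _; rewrite mxE mulNr. Qed.

Lemma dotZl a u v : dot (a *: u) v = a * dot u v.
Proof. by rewrite mulr_sumr; apply: eq_bigr => i _; rewrite mxE mulrA. Qed.

Lemma dotDr u v w : dot u (v + w) = dot u v + dot u w.
Proof. by rewrite dotC dotDl !(dotC u). Qed.

Lemma dotNr u v : dot u (- v) = - dot u v.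
Proof. by rewrite dotC dotNl dotC. Qed.

Lemma dotZr a u v : dot u (a *: v) = a * dot u v.
Proof. by rewrite dotC dotZl dotC. Qed.

Lemma dot_sumr (I : Type) (s : seq I) (P : pred I) (f : I -> V) u :
  dot u (\sum_(i <- s | P i) f i) = \sum_(i <- s | P i) dot u (f i).
Proof.
elim/big_rec2: _ => [|i a b _ <-]; last exact: dotDr.
by rewrite -(scale0r 0) dotZr mul0r.
Qed.

Definition dotE := (dotDl, dotDr, dotNl, dotNr, dotZl, dotZr).

Lemma dot_ge0 u : 0 <= dot u u.
Proof. by apply: sumr_ge0 => i _; rewrite -expr2 sqr_ge0. Qed.

Lemma enorm_ge0 u : 0 <= enorm u.
Proof. exact: sqrtr_ge0. Qed.

Lemma enorm2E u : enorm u ^+ 2 = dot u u.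
Proof. by rewrite sqr_sqrtr ?dot_ge0. Qed.

Lemma le_enorm u v : (enorm u <= enorm v) = (dot u u <= dot v v).
Proof. by rewrite ler_sqrt ?dot_ge0. Qed.

(** Expansion of |c u - v|^2 >= 0, divided by c. The weight is 2 gamma in the coercivity of the prox
    objective and 1 / ell in the Lipschitz bound. *)
Lemma dot_le_young (c : R) u v : 0 < c -> 2 * dot u v <= c * dot u u + c^-1 * dot v v.
Proof.
move=> c0; have := dot_ge0 (c *: u - v); rewrite !dotE => h.
rewrite (dotC v u) in h.
rewrite -(ler_pM2l c0) mulrDr (mulrA c c^-1) mulfV ?gt_eqF// mul1r.
nra.
Qed.

Lemma dot_young u v : 2 * dot u v <= dot u u + dot v v.
Proof. by have := @dot_le_young 1 u v ltr01; rewrite invr1 !mul1r. Qed.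

Lemma dotD_le2 u v : dot (u + v) (u + v) <= 2 * (dot u u + dot v v).
Proof. by have := dot_young u v; rewrite !dotE (dotC v u) => h; lra. Qed.

(** For v nonzero, expand the square of |v|^2 u - <u, v> v and divide by |v|^2. When |v|^2 = 0 all
    coordinates of v vanish. *)
Lemma cauchy_schwarz u v : dot u v ^+ 2 <= dot u u * dot v v.
Proof.
have [v0|v0] := eqVneq (dot v v) 0.
  suff -> : dot u v = 0 by rewrite expr0n mulr_ge0 ?dot_ge0.
  rewrite /dot big1// => i _.
  have /eqP := v0; rewrite psumr_eq0; last by move=> j _; rewrite -expr2 sqr_ge0.
  by move=> /allP /(_ i (mem_index_enum i)); rewrite /= mulf_eq0 orbb => /eqP ->;
    rewrite mulr0.
have vp : 0 < dot v v by rewrite lt_def v0 dot_ge0.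
have := dot_ge0 (dot v v *: u - dot u v *: v); rewrite !dotE (dotC v u) => h.
rewrite -(ler_pM2l vp); nra.
Qed.

Lemma dot_le_enorm u v : dot u v <= enorm u * enorm v.
Proof.
rewrite -sqrtrM ?dot_ge0//; apply: le_trans (ler_norm _) _.
by rewrite -sqrtr_sqr ler_wsqrtr// cauchy_schwarz.
Qed.

Lemma enormN u : enorm (- u) = enorm u.
Proof. by rewrite /enorm !dotE opprK. Qed.

Lemma enormD u v : enorm (u + v) <= enorm u + enorm v.
Proof.
rewrite -(ler_pXn2r (n:=2))// ?nnegrE ?addr_ge0 ?enorm_ge0//.
rewrite sqrrD !enorm2E !dotE (dotC v u).
by have := dot_le_enorm u v; rewrite mulr2n => h; lra.
Qed.

Lemma enormB u v : enorm (u - v) = enorm (v - u).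
Proof. by rewrite -enormN opprB. Qed.

Lemma enorm_coord u i : `|u 0 i| <= enorm u.
Proof.
rewrite -sqrtr_sqr ler_wsqrtr// /dot (bigD1 i)//= -expr2 lerDl.
by apply: sumr_ge0 => j _; rewrite -expr2 sqr_ge0.
Qed.

Lemma enorm0_eq0 u : enorm u <= 0 -> u = 0.
Proof.
move=> u0; apply/rowP => i; rewrite mxE; apply/eqP; rewrite -normr_le0.
exact: le_trans (enorm_coord _ _) u0.
Qed.

Lemma norm_le_enorm u : `|u| <= enorm u.
Proof.
rewrite [leLHS](mx_normrE u); apply: bigmax_le; first exact: enorm_ge0.
by move=> [i j] _ /=; rewrite (ord1 i) enorm_coord.
Qed.

Lemma coord_le_norm u i : `|u 0 i| <= `|u|.
Proof.
rewrite [leRHS](mx_normrE u).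
by apply/bigmax_geP; right; exists (0, i).
Qed.

Lemma enorm_le_norm u : enorm u <= Num.sqrt d%:R * `|u|.
Proof.
rewrite -(ler_pXn2r (n:=2))// ?nnegrE ?enorm_ge0 ?mulr_ge0 ?sqrtr_ge0//.
rewrite enorm2E exprMn sqr_sqrtr ?ler0n//.
apply: (@le_trans _ _ (\sum_(i < d) `|u| ^+ 2)).
  apply: ler_sum => i _; rewrite -expr2 -real_normK ?num_real//.
  by rewrite lerXn2r ?nnegrE ?coord_le_norm.
by rewrite sumr_const card_ord mulr_natl.
Qed.

Lemma coord_rV_continuous (i : 'I_d) : continuous (fun u : V => u 0 i).
Proof. exact: coord_continuous. Qed.

Lemma continuous_dot (T : topologicalType) (f g : T -> V) :
  continuous f -> continuous g -> continuous (fun t => dot (f t) (g t)).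
Proof.
move=> cf cg; apply: (@continuous_big R) => [|i _ t]; first exact: add_continuous.
apply: cvgM.
  by apply: (@continuous_comp _ _ _ f (fun u : V => u 0 i));
    [exact: cf|exact: coord_rV_continuous].
by apply: (@continuous_comp _ _ _ g (fun u : V => u 0 i));
  [exact: cg|exact: coord_rV_continuous].
Qed.

Lemma continuous_enorm (T : topologicalType) (f : T -> V) :
  continuous f -> continuous (fun t => enorm (f t)).
Proof.
move=> cf t; apply: (@continuous_comp _ _ _ (fun t => dot (f t) (f t)) Num.sqrt).
  exact: continuous_dot.
exact: sqrt_continuous.
Qed.

Lemma enorm_nbhs u (A : set V) (e : R) :
  0 < e -> (forall v, enorm (u - v) < e -> A v) -> nbhs u A.
Proof.
(* The sup norm and the Euclidean norm differ by at most the factor sqrt d; the [+ 1] keeps the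
   divisor positive when d = 0. *)
move=> e0 uA; have s0 : 0 < Num.sqrt d%:R + 1 :> R by rewrite ltr_wpDl ?sqrtr_ge0.
apply/(@nbhs_normP R V u A); exists (e / (Num.sqrt d%:R + 1)); first exact: divr_gt0.
move=> v /=; rewrite ltr_pdivlMr// mulrC => uve; apply: uA.
apply: le_lt_trans (enorm_le_norm _) _; apply: le_lt_trans uve.
by rewrite ler_wpM2r// lerDl.
Qed.

Lemma enorm_continuous (f : V -> V) :
  (forall u e, 0 < e ->
    exists2 a, 0 < a & forall v, enorm (u - v) < a -> enorm (f u - f v) < e) ->
  continuous f.
Proof.
move=> fc u; apply/(@cvgrPdist_lt R V V (nbhs u)) => e e0.
have [a a0 fa] := fc u e e0.
apply: (enorm_nbhs a0) => v /fa; exact: le_lt_trans (norm_le_enorm _).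
Qed.

Lemma enorm_bounded_set (A : set V) (M : R) :
  (forall u, A u -> enorm u <= M) -> bounded_set A.
Proof.
move=> AM; exists M; split; first exact: num_real.
move=> x Mx u /AM uM; apply: le_trans (norm_le_enorm u) _.
exact: le_trans uM (ltW Mx).
Qed.

End EuclideanTheory.

(** * Proximal operator *)

Lemma seq_min_exists (T : eqType) (R : realType) (f : T -> \bar R) (s : seq T) :
  s != [::] -> exists2 i, i \in s & forall j, j \in s -> (f i <= f j)%E.
Proof.
elim: s => // a [_ _|b s /(_ isT)[i iS imin] _].
  by exists a => [|j]; rewrite inE// => /eqP ->.
have [ai|ia] := leP (f a) (f i).
  exists a; rewrite ?mem_head// => j; rewrite inE => /predU1P[->//|/imin].
  exact: le_trans.
exists i; first by rewrite inE iS orbT.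
by move=> j; rewrite inE => /predU1P[->|/imin//]; exact: ltW.
Qed.

(** Without a minimizer, the open sets {y | f z < f y}, for z in A, cover A. Among the indices of a
    finite subcover, one with the least value of f lies in none of the chosen sets, although it
    belongs to A. *)
Lemma lsc_min_compact (T : ptopologicalType) (R : realType) (f : T -> \bar R)
    (A : set T) :
  lower_semicontinuous f -> compact A -> A !=set0 ->
  exists2 y, A y & forall z, A z -> (f y <= f z)%E.
Proof.
move=> /lower_semicontinuousP lscf; rewrite compact_cover => cA [a Aa].
apply: contrapT => nomin.
have smaller y : A y -> exists2 z, A z & (f z < f y)%E.
  move=> Ay; apply: contrapT => nz; apply: nomin; exists y => // z Az.
  by rewrite leNgt; apply/negP => zy; apply: nz; exists z.
have [z Az|y /smaller[z Az zy]|D DA AD] :=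
    cA T A (fun z => [set y | (f z < f y)%E]).
- have [t At] := smaller z Az; case: (f z) => [s _| _|]; first exact: lscf.
    rewrite (_ : [set _ | _] = set0); first exact: open0.
    by apply/seteqP; split => // y /=; rewrite ltNge leey.
  by rewrite ltNge leNye.
- by exists z.
have D0 : finmap.enum_fset D != [::].
  have /AD [i /= iD _] := Aa.
  by apply/negP => /eqP D0; move: (iD : i \in finmap.enum_fset D); rewrite D0.
have [i iD imin] := seq_min_exists f D0.
have /AD [j /= jD ji] := set_mem (DA i iD).
by have := imin j jD; rewrite leNgt ji.
Qed.

Lemma lsc_add_continuous (T : topologicalType) (R : realType)
    (f : T -> \bar R) (g : T -> R) :
  (forall t, f t != -oo%E) -> lower_semicontinuous f -> continuous g ->
  lower_semicontinuous (fun t => f t + (g t)%:E)%E.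
Proof.
move=> fNy lscf cg t a afg.
have near_g e : 0 < e -> nbhs t [set s | g t - e < g s].
  by move=> e0; move/cvgrPdist_lt : (cg t) => /(_ e e0); apply: filterS => s /=;
    rewrite ltr_distl => /andP[_]; rewrite ltrBlDr.
have lower b e : 0 < e -> (b%:E < f t)%E -> a <= b + g t - e ->
    exists2 V, nbhs t V & forall y, V y -> (a%:E < f y + (g y)%:E)%E.
  move=> e0 /lscf[V tV Vf] abe; exists (V `&` [set s | g t - e < g s]).
    by apply: filterI => //; exact: near_g.
  move=> s [/Vf bf /= gs].
  apply: (@le_lt_trans _ _ (b%:E + (g t - e)%:E)%E).
    by rewrite -EFinD lee_fin addrA.
  by apply: lteD => //; rewrite lte_fin.
(* Where f t = +oo, the level b = a - g t + 1 and the loss e = 1 suffice. Where f t = s is finite,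
   the slack s + g t - a is shared equally between f and g. *)
case: (f t) afg (fNy t) lower => [s|_|//]; last first.
  move=> _ /(_ (a - g t + 1) 1 ltr01); apply; first exact: ltry.
  lra.
rewrite -EFinD lte_fin => asg _ /(_ (s - (s + g t - a) / 2) ((s + g t - a) / 2)).
apply; rewrite ?lte_fin; lra.
Qed.

Lemma continuous_subr (R : realType) (d : nat) (x : 'rV[R]_d) :
  continuous (fun y : 'rV[R]_d => y - x).
Proof.
by apply: enorm_continuous => u e e0; exists e => // v; rewrite opprB addrA subrK.
Qed.

Section Prox.
Context {R : realType} {d : nat}.
Local Notation V := 'rV[R]_d.
Variables (r : V -> \bar R) (gamma : R).
Hypotheses (r_proper : proper_fun r) (r_lsc : lower_semicontinuous r).
Hypotheses (r_convex : econvex_fun r) (gamma_gt0 : 0 < gamma).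
Hypothesis r_minorant : exists (c : R) (g : V), forall y, ((c + dot g y)%:E <= r y)%E.

Let phi x y : \bar R := (r y + (enorm (y - x) ^+ 2 / (2 * gamma))%:E)%E.

(** The affine minorant makes the objective coercive, so the sublevel set through a point of finite
    value is bounded. It is closed by lower semicontinuity, hence compact, and a minimizer on it is
    a global one. *)
Lemma prox_minimizes x : minimizers setT (phi x) (prox gamma r x).
Proof.
suff [y ymin] : exists y, minimizers setT (phi x) y by exact: xgetI ymin.
have [rNy [z0 rz0]] := r_proper; have [c [g cg]] := r_minorant.
have phi_lsc : lower_semicontinuous (phi x).
  apply: lsc_add_continuous => //=.
  move=> t; apply: (@cvgM _ _ (nbhs t) _ (fun y => enorm (y - x) ^+ 2)
    (cst (2 * gamma)^-1)); last exact: cvg_cst.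
  rewrite (_ : (fun t => _) = fun t => dot (t - x) (t - x)); last first.
    by apply/funext => ?; rewrite enorm2E.
  rewrite /= enorm2E.
  exact: (continuous_dot (@continuous_subr _ _ x) (@continuous_subr _ _ x)).
pose m := fine (phi x z0).
have mE : phi x z0 = m%:E by rewrite fineK// fin_numD rz0.
pose S := [set y | (phi x y <= m%:E)%E].
have cS : compact S.
  apply: bounded_closed_compact.
    (* Young's inequality with weight 2 gamma gives -<g, y - x> <= gamma |g|^2 + |y - x|^2 / (4
       gamma). The last term uses up half of the quadratic part of the objective, which leaves |y -
       x|^2 <= M. *)
    pose M := 4 * gamma * (m - c - dot g x + gamma * dot g g).
    apply: (@enorm_bounded_set _ _ _ (Num.sqrt M + enorm x)) => y Sy.
    have -> : y = (y - x) + x by rewrite subrK.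
    apply: le_trans (enormD _ _) _; rewrite lerD2r.
    have : ((c + dot g y)%:E + (enorm (y - x) ^+ 2 / (2 * gamma))%:E <= m%:E)%E.
      by apply: le_trans Sy; rewrite leeD2r.
    rewrite -EFinD lee_fin enorm2E => h.
    have := @dot_le_young _ _ (2 * gamma) (- g) (y - x) (mulr_gt0 (ltr0n _ 2) gamma_gt0).
    rewrite !dotNl dotNr opprK => h2; apply: ler_wsqrtr; rewrite /M.
    have gy : dot g y = dot g x + dot g (y - x).
      by rewrite -dotDr addrC subrK.
    have gk : (2 * gamma) * (2 * gamma)^-1 = 1 by rewrite mulfV// gt_eqF// mulr_gt0.
    move: h h2 gk; set k := _^-1; set q := dot (y - x) _; rewrite gy => h h2 gk.
    have : q * k <= 2 * (m - c - dot g x + gamma * dot g g) by lra.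
    rewrite -(ler_pM2l (mulr_gt0 (ltr0n R 2) gamma_gt0)) mulrCA gk mulr1.
    lra.
  rewrite -(setCK S); apply: open_closedC.
  rewrite (_ : ~` S = [set y | (m%:E < phi x y)%E]); last first.
    by apply/seteqP; split => y /=; rewrite ltNge => /negP.
  by move/lower_semicontinuousP : phi_lsc; exact.
have [y Sy ymin] : exists2 y, S y & forall z, S z -> (phi x y <= phi x z)%E.
  by apply: lsc_min_compact => //; exists z0; rewrite /S /= mE.
exists y; split => // z _; have [/ymin//|mz] := leP (phi x z) m%:E.
by apply: (le_trans Sy); exact: ltW.
Qed.

Lemma prox_fin_num x : r (prox gamma r x) \is a fin_num.
Proof.
have [rNy [z0 rz0]] := r_proper; have [_ /(_ z0 I)] := prox_minimizes x.
rewrite fin_numE rNy /phi -(fineK rz0) -EFinD => h; apply/negP => /eqP r_oo.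
by move: h; rewrite r_oo addye// leNgt ltry.
Qed.

(** First-order optimality of p without subgradients: compare the objective at p and at p + t (u -
    p), use convexity of r, divide by t and let t tend to 0. *)
Lemma prox_le x u (p := prox gamma r x) : r u \is a fin_num ->
  dot (x - p) (u - p) <= gamma * (fine (r u) - fine (r p)).
Proof.
move=> ru; have rp : r p \is a fin_num := prox_fin_num x.
set U := fine (r u); set Q := fine (r p).
set e := dot (p - x) (u - p); set N := dot (u - p) (u - p).
have step t : 0 < t <= 1 -> t * (2 * gamma * (Q - U) - 2 * e) <= t * (t * N).
  move=> /andP[t0 t1]; have [_ /(_ (t *: u + (1 - t) *: p) I)] := prox_minimizes x.
  rewrite -/p /phi => h.
  have t01 : 0 <= t <= 1 by rewrite ltW.
  have := le_trans h (leeD2r _ (r_convex u p t01)).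
  rewrite -(fineK ru) -(fineK rp) -!EFinM -!EFinD lee_fin -/U -/Q !enorm2E.
  have -> : t *: u + (1 - t) *: p - x = (p - x) + t *: (u - p).
    by apply/rowP => i; rewrite !mxE; ring.
  rewrite (dotDl (p - x)) 2!(dotDr _ (p - x)) !(dotZl, dotZr) (dotC (u - p)) -/e -/N.
  have gk : (2 * gamma) * (2 * gamma)^-1 = 1 by rewrite mulfV// gt_eqF// mulr_gt0.
  move: gk; set k := _^-1; set D := dot (p - x) (p - x) => gk {}h.
  have : Q - t * U - (1 - t) * Q <= (2 * t * e + t * (t * N)) * k by lra.
  move=> /(ler_wpM2l (ltW (mulr_gt0 (ltr0n R 2) gamma_gt0))).
  rewrite [X in _ <= X -> _]mulrCA gk mulr1; lra.
rewrite -[x - p]opprB dotNl -/e; suff : 2 * gamma * (Q - U) - 2 * e <= 0 by lra.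
(* The limit t -> 0 is replaced by one explicit value: if X > 0, then t = X / (X + N) gives t N < X,
   against X <= t N from [step]. *)
rewrite leNgt; apply/negP; set X := _ - _ => X0.
have N0 : 0 <= N by exact: dot_ge0.
have XN : 0 < X + N by rewrite ltr_wpDr.
have t0 : 0 < X / (X + N) by rewrite divr_gt0.
have /step : 0 < X / (X + N) <= 1 by rewrite t0 ler_pdivrMr// mul1r lerDl.
rewrite ler_pM2l// -/X leNgt => /negP; apply.
by rewrite mulrAC ltr_pdivrMr// ltr_pM2l// ltrDr.
Qed.

(** Adding the optimality inequalities of the two prox points p and q, each tested at the other,
    cancels r and leaves |p - q|^2 <= <x - y, p - q>; Young's inequality concludes. *)
Lemma prox_nonexpansive x y :
  enorm (prox gamma r x - prox gamma r y) <= enorm (x - y).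
Proof.
set p := prox _ _ x; set q := prox _ _ y.
have := prox_le x (prox_fin_num y); have := prox_le y (prox_fin_num x).
rewrite -/p -/q le_enorm; move: (fine _) (fine _) => rp rq.
move: p q => p q h1 h2.
have h3 := dot_young (x - y) (p - q); move: h1 h2 h3; rewrite !dotE.
rewrite (dotC q p) (dotC x y) (dotC y p) (dotC y q) (dotC x p) (dotC x q); lra.
Qed.

Lemma prox_continuous : continuous (prox gamma r).
Proof.
apply: enorm_continuous => u e e0; exists e => // v.
exact: le_lt_trans (prox_nonexpansive _ _).
Qed.

End Prox.

(** * Borel measurability in R^d *)

Section BorelVectors.
Context {R : realType} {d : nat}.
Local Notation V := 'rV[R]_d.
Local Notation B := (borel_rV R d).

Lemma open_measurable_rV (A : set V) : open A -> measurable (A : set B).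
Proof. exact: sub_sigma_algebra. Qed.

Lemma continuous_measurable_rV (f : V -> V) :
  continuous f -> measurable_fun [set: B] (f : B -> B).
Proof.
move=> cf; apply: (@measurability _ _ _ B _ _ [set A : set V | open A]) => //.
move=> _ [A oA <-]; rewrite setTI; apply: open_measurable_rV.
by move/continuousP : cf; exact.
Qed.

Lemma measurable_coord_rV (i : 'I_d) :
  measurable_fun [set: B] (fun u : B => (u : V) 0 i).
Proof.
apply: (measurability _ (RGenOpens.measurableE R)) => _ [_ [a [b ->]] <-].
rewrite setTI; apply: open_measurable_rV.
by move/continuousP : (@coord_rV_continuous R d i); apply; exact: interval_open.
Qed.

(** An open set is the countable union of the rational boxes that it contains, and the preimage of a
    box is a finite intersection of preimages under the coordinates. *)
Lemma measurable_rVP {dT} {T : measurableType dT} (f : T -> B) :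
  (forall i : 'I_d, measurable_fun [set: T] (fun t => (f t : V) 0 i)) ->
  measurable_fun [set: T] f.
Proof.
move=> mf; apply: (@measurability _ _ _ B _ _ [set A : set V | open A]) => //.
move=> _ [A oA <-]; rewrite setTI.
pose box (q : 'rV[rat]_d * nat) : set V :=
  [set u | forall i, `|u 0 i - ratr (q.1 0 i)| < q.2.+1%:R^-1].
have -> : f @^-1` A = \bigcup_(q in [set q | box q `<=` A]) (f @^-1` box q).
  apply/seteqP; split => [t Aft|t [q qA] /qA//].
  have [/= e e0 eA] : exists2 e : R, 0 < e & ball (f t : V) e `<=` A.
    by apply/nbhs_ballP; exact: open_nbhs_nbhs.
  (* Two points of one box of radius 1/n are less than 2/n <= e apart in each coordinate. The box
     index is n - 1, because [box] adds one to it. *)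
  pose n := (Num.bound (2 / e)).+1.
  have n0 : 0 < n%:R^-1 :> R by rewrite invr_gt0 ltr0n.
  have ne : n%:R^-1 + n%:R^-1 <= e.
    have : 2 / e <= n%:R.
      apply: ltW; apply: (@lt_trans _ _ (Num.bound (2 / e))%:R); last by rewrite ltr_nat.
      by rewrite archi_boundP// divr_ge0// ltW.
    by rewrite ler_pdivrMr// -mulr2n -[X in _ -> X <= _]mulr_natl ler_pdivrMr ?ltr0n// mulrC.
  have /choice[q qf] : forall i : 'I_d,
      exists q : rat, `|(f t : V) 0 i - ratr q| < n%:R^-1.
    move=> i; have /rat_in_itvoo[q] : (f t : V) 0 i - n%:R^-1 < (f t : V) 0 i + n%:R^-1.
      by rewrite ltrBlDr -addrA ltrDl addr_gt0.
    rewrite in_itv /= => /andP[q1 q2]; exists q; rewrite distrC ltr_distl.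
    by rewrite q1 q2.
  exists (\row_i q i, Num.bound (2 / e)) => /=; last by move=> i; rewrite mxE.
  move=> u /= uq; apply: eA; split => // i j; rewrite (ord1 i).
  apply: lt_le_trans ne; rewrite -[X in `|X|](subrKA (ratr (q j))).
  apply: le_lt_trans (ler_normD _ _) _; apply: ltrD => //.
  by have := uq j; rewrite mxE distrC.
rewrite bigcup_mkcond; apply: countable_bigcupT_measurable => // q.
case: ifPn => // _; rewrite (_ : f @^-1` box q = \bigcap_(i in [set: 'I_d])
    ((fun t => `|(f t : V) 0 i - ratr (q.1 0 i)|) @^-1` `]-oo, q.2.+1%:R^-1[)).
  apply: fin_bigcap_measurable => // i _; rewrite -[X in measurable X]setTI.
  apply: (measurableT_comp (@normr_measurable R setT)) => //.
  by apply: measurable_funB.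
apply/seteqP; split => t /= h i; first by rewrite /= in_itv /= h.
by have := h i I; rewrite /= in_itv.
Qed.

Lemma measurable_dot {dT} {T : measurableType dT} (f g : T -> B) :
  measurable_fun [set: T] f -> measurable_fun [set: T] g ->
  measurable_fun [set: T] (fun t => dot (f t : V) (g t : V)).
Proof.
move=> mf mg; apply: measurable_sum => i.
by apply: measurable_funM; apply: (measurableT_comp (measurable_coord_rV i)).
Qed.

Lemma measurable_addr_rV {dT} {T : measurableType dT} (f g : T -> B) :
  measurable_fun [set: T] f -> measurable_fun [set: T] g ->
  measurable_fun [set: T] (fun t => (f t : V) + (g t : V) : B).
Proof.
move=> mf mg; apply: measurable_rVP => i.
under eq_fun do rewrite mxE.
by apply: measurable_funD; apply: (measurableT_comp (measurable_coord_rV i)).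
Qed.

Lemma measurable_scaler_rV {dT} {T : measurableType dT} (a : R) (f : T -> B) :
  measurable_fun [set: T] f ->
  measurable_fun [set: T] (fun t => a *: (f t : V) : B).
Proof.
move=> mf; apply: measurable_rVP => i.
under eq_fun do rewrite mxE.
by apply: measurable_funM => //; apply: (measurableT_comp (measurable_coord_rV i)).
Qed.

Lemma measurable_subr_rV {dT} {T : measurableType dT} (f g : T -> B) :
  measurable_fun [set: T] f -> measurable_fun [set: T] g ->
  measurable_fun [set: T] (fun t => (f t : V) - (g t : V) : B).
Proof.
move=> mf mg; apply: measurable_addr_rV => //.
rewrite (_ : (fun t => _) = fun t => (-1) *: (g t : V)).
  exact: measurable_scaler_rV.
by apply/funext => t; rewrite scaleN1r.
Qed.

End BorelVectors.

(** * Independence of a sample from the past *)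

Section Freezing.
Context {R : realType} {dO dXi dT : measure_display}.
Context {Om : measurableType dO} {Xi : measurableType dXi} {T : measurableType dT}.

(** Independence on measurable rectangles identifies the joint law of (X, Z) with the product of D
    and the law of Z. Tonelli's theorem then integrates out the first variable with the second one
    frozen. *)
Lemma integral_freeze (P : probability Om R) (D : probability Xi R)
    (X : Om -> Xi) (Z : Om -> T) (h : Xi * T -> \bar R) :
  measurable_fun setT X -> measurable_fun setT Z ->
  (forall A B, measurable A -> measurable B ->
    P (X @^-1` A `&` Z @^-1` B) = (D A * P (Z @^-1` B))%E) ->
  measurable_fun setT h -> (forall z, (0 <= h z)%E) ->
  (\int[P]_w h (X w, Z w) = \int[P]_w \int[D]_a h (a, Z w))%E.
Proof.
move=> mX mZ XZ mh h0.
pose Z' : {RV P >-> T} := mfun_Sub (mem_set mZ).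
have mXZ : measurable_fun setT (fun w => (X w, Z w)) by exact: measurable_fun_pair.
pose XZ' : {RV P >-> (Xi * T)%type} := mfun_Sub (mem_set mXZ).
transitivity (\int[distribution P XZ']_p h p)%E.
  by rewrite ge0_integral_distribution.
transitivity (\int[D \x distribution P Z']_p h p)%E.
  apply: eq_measure_integral => A mA _; apply/esym.
  by apply: product_measure_unique => // A1 A2 mA1 mA2; exact: XZ.
rewrite fubini_tonelli2// ge0_integral_distribution//.
  exact: measurable_fun_fubini_tonelli_G.
by move=> z; exact: integral_ge0.
Qed.

End Freezing.

Section Process.
Context {R : realType} {dXi dT : measure_display}.
Context {Xi : measurableType dXi} {T : measurableType dT}.
Variables (step : Xi * T -> T) (z0 : T).

(** The recursion is driven by a deterministic sample path, so that it can be rerun on a path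
    altered at one index. *)
Fixpoint process (xs : nat -> Xi) (k : nat) : T :=
  if k is k'.+1 then step (xs k', process xs k') else z0.

Lemma eq_process (xs ys : nat -> Xi) k :
  (forall j, (j < k)%N -> xs j = ys j) -> process xs k = process ys k.
Proof.
elim: k => //= k IH xy; rewrite xy// IH// => j jk.
by apply: xy; exact: leqW.
Qed.

Hypothesis mstep : measurable_fun setT step.

(** Only the samples before time k need be measurable, and the sigma-algebra on [Om] is arbitrary;
    this allows the sigma-algebra of the past, for which later samples may fail to be measurable. *)
Lemma measurable_process {dO} {Om : measurableType dO} (xi : nat -> Om -> Xi) k :
  (forall j, (j < k)%N -> measurable_fun setT (xi j)) ->
  measurable_fun setT (fun w => process (xi ^~ w) k).
Proof.
elim: k => [_|k IH mxi] /=; first exact: measurable_cst.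
apply: (measurableT_comp mstep); apply: measurable_fun_pair; first exact: mxi.
by apply: IH => j jk; apply: mxi; exact: leqW.
Qed.

End Process.

Section IndependentSamples.
Context {R : realType} {dO dXi dT : measure_display}.
Context {Om : measurableType dO} {Xi : measurableType dXi} {T : measurableType dT}.
Variables (P : probability Om R) (D : probability Xi R).
Variable xi : nat -> {RV P >-> Xi}.
Hypothesis iid : iid_samples D xi.

(** A pi-system that generates the sigma-algebra of the samples before time k. *)
Definition past_cylinders (k : nat) : set (set Om) :=
  [set E | exists2 A : nat -> set Xi, (forall j, measurable (A j)) &
    E = \bigcap_(j in [set` iota 0 k]) (xi j @^-1` A j)].

Lemma measurable_sample_preimage k A :
  measurable A -> measurable (xi k @^-1` A).
Proof. by move=> mA; rewrite -[X in measurable X]setTI; apply: measurable_funPT. Qed.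

Lemma past_cylinders_measurable k : past_cylinders k `<=` measurable.
Proof.
move=> _ [A mA ->]; apply: fin_bigcap_measurable => // j _.
exact: measurable_sample_preimage.
Qed.

Lemma past_cylinders_setI k : setI_closed (past_cylinders k).
Proof.
move=> _ _ [A mA ->] [A' mA' ->]; exists (fun j => A j `&` A' j).
  by move=> j; exact: measurableI.
by rewrite -bigcapI; apply: eq_bigcapr.
Qed.

Lemma past_cylindersT k : past_cylinders k setT.
Proof.
exists (fun=> setT) => //; apply/seteqP; split => // w _ j _ //.
Qed.

(** For fixed X, both sides are finite measures in E. They agree on the pi-system of past cylinders
    by mutual independence, hence on the sigma-algebra it generates. *)
Lemma sample_indep_past k X E : measurable X -> <<s past_cylinders k >> E ->
  P (xi k @^-1` X `&` E) = (D X * P E)%E.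
Proof.
move=> mX; have [dist indep] := iid.
have mxX : measurable (xi k @^-1` X) by exact: measurable_sample_preimage.
have PX : P (xi k @^-1` X) = D X by rewrite -(dist k).
have cX : (0 <= fine (D X))%R by rewrite fine_ge0.
have DXE : D X = (fine (D X))%:E by rewrite fineK// fin_num_measure.
move=> sE; rewrite setIC DXE.
apply: (@g_sigma_algebra_measure_unique _ _ _ (past_cylinders k) _
  (fun=> setT) _ _ (mrestr P mxX) (mscale (NngNum cX) P)) => //.
- exact: past_cylinders_measurable.
- by move=> _; exact: past_cylindersT.
- by apply/seteqP; split => // w _; exists 0%N.
- exact: past_cylinders_setI.
- move=> _ [A mA ->]; rewrite /= /mrestr /mscale /= setIC [X in _ = (X * _)%E](_ : _ = D X)//.
  (* Inserting X at index k turns the intersection into a cylinder over 0, ..., k. Independence is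
     applied to this cylinder and to the one over 0, ..., k - 1, and the two products differ by the
     factor D(X). *)
  pose A' j := if j == k then X else A j.
  have mA' j : measurable (A' j) by rewrite /A'; case: ifP.
  have AA' j : j \in iota 0 k -> A' j = A j.
    by rewrite mem_iota /= add0n /A' => jk; rewrite ltn_eqF.
  have Ak : A' k = X by rewrite /A' eqxx.
  have := indep (iota 0 k.+1) A' (iota_uniq _ _) mA'.
  rewrite -{2}addn1 iotaD big_cat big_seq1 /= add0n Ak PX.
  under eq_big_seq => j jk do rewrite AA'//.
  rewrite -indep ?iota_uniq// muleC => <-; congr (P _).
  apply/seteqP; split => [w [wX wA] j|w wA].
    rewrite -[X in X -> _]/(is_true (j \in iota 0 k.+1)) mem_iota /= add0n ltnS.
    rewrite leq_eqVlt => /predU1P[->|jk].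
      by rewrite Ak.
    by rewrite AA' ?mem_iota//; apply: wA; rewrite /= mem_iota.
  have past j : j \in iota 0 k -> j \in iota 0 k.+1.
    by rewrite !mem_iota; exact: leqW.
  have kin : k \in iota 0 k.+1 by rewrite mem_iota /= ltnS.
  split; first by rewrite -Ak; exact: wA kin.
  by move=> j jk; rewrite /= -AA'//; apply: wA; exact: past.
- by move=> _; rewrite /= /mrestr setTI ltey_eq fin_num_measure.
Qed.

Variables (step : Xi * T -> T) (z0 : T).
Hypothesis mstep : measurable_fun setT step.
Local Notation Z k w := (process step z0 (xi ^~ w) k).

(** Measurability of the process is applied with [Om] carrying the sigma-algebra generated by the
    past cylinders. *)
Lemma process_past k B : measurable B ->
  <<s past_cylinders k >> ((fun w => Z k w) @^-1` B).
Proof.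
move=> mB; pose Om' := g_sigma_algebraType (past_cylinders k).
have := @measurable_process _ _ _ _ step z0 mstep _ Om' xi k.
rewrite -[X in <<s _ >> X]setTI; apply => // j jk _ A mA.
rewrite setTI; apply: sub_sigma_algebra.
exists (fun i => if i == j then A else setT) => [i|]; first by case: ifP.
apply/seteqP; split => [w wA i _ /=|w wA /=].
  by case: eqP => // ->.
by have := wA j; rewrite /= mem_iota/= add0n eqxx; exact.
Qed.

Lemma integral_process_step k (h : Xi * T -> \bar R) :
  measurable_fun setT h -> (forall z, (0 <= h z)%E) ->
  (\int[P]_w h (xi k w, Z k w) = \int[P]_w \int[D]_a h (a, Z k w))%E.
Proof.
move=> mh h0; apply: (integral_freeze (X := xi k) (Z := fun w => Z k w)) => //.
- by apply: measurable_process => // j _; exact: measurable_funPT.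
- by move=> A B mA mB; apply: sample_indep_past => //; exact: process_past.
Qed.

End IndependentSamples.

(** * Measurability of the mean oracle and of the projection *)

(** Each coordinate of F is the difference of the integrals over the sample of the positive and
    negative parts of the oracle, and both are measurable in x by Tonelli's theorem. *)
Lemma measurable_mean_oracle (R : realType) (d : nat) (dXi : measure_display)
    (Xi : measurableType dXi) (D : probability Xi R)
    (Fxi : Xi -> 'rV[R]_d -> 'rV[R]_d) (F : 'rV[R]_d -> 'rV[R]_d) :
  measurable_oracle Fxi -> unbiased_oracle D Fxi F ->
  measurable_fun [set: borel_rV R d] (F : borel_rV R d -> borel_rV R d).
Proof.
move=> mFxi unb; apply: measurable_rVP => i; apply/measurable_EFinP.
pose f (p : Xi * borel_rV R d) : \bar R := (Fxi p.1 p.2 0 i)%:E.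
have mf : measurable_fun setT f by apply/measurable_EFinP; exact: mFxi.
rewrite (_ : _ \o _ = fun x => (fubini_G D f^\+ x - fubini_G D f^\- x)%E).
  by apply: emeasurable_funB; apply: measurable_fun_fubini_tonelli_G => //;
    [exact: measurable_funepos|exact: measurable_funeneg].
apply/funext => x /=; have [_ <-] := unb x i.
rewrite unlock integralE; congr (_ - _)%E; apply: eq_integral => a _.
  by rewrite !funeposE.
by rewrite !funenegE.
Qed.

Lemma measurable_comp_oracle (R : realType) (d : nat) (dXi dT : measure_display)
    (Xi : measurableType dXi) (T : measurableType dT)
    (Fxi : Xi -> 'rV[R]_d -> 'rV[R]_d) (a : T -> Xi) (x : T -> borel_rV R d) :
  measurable_oracle Fxi -> measurable_fun setT a -> measurable_fun setT x ->
  measurable_fun setT (fun t => Fxi (a t) (x t) : borel_rV R d).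
Proof.
move=> mFxi ma mx; apply: measurable_rVP => i.
apply: (@measurableT_comp _ _ _ T (Xi * borel_rV R d)%type R _ setT
  (fun t => (a t, x t)) (mFxi i)).
exact: measurable_fun_pair.
Qed.

Section Projection.
Context {R : realType} {d : nat}.
Local Notation V := 'rV[R]_d.
Variable X : set V.
Hypothesis Xproj : proj_well_defined X.

Lemma proj_in x : X (proj X x).
Proof. by have [y [ymin _]] := Xproj x; have [] := xgetI 0 ymin. Qed.

Lemma proj_le x z : X z -> enorm (proj X x - x) <= enorm (z - x).
Proof.
move=> Xz; have [y [ymin _]] := Xproj x; have [_ /(_ z Xz)] := xgetI 0 ymin.
by rewrite lee_fin.
Qed.

Lemma proj_unique x y : X y -> enorm (y - x) <= enorm (proj X x - x) ->
  y = proj X x.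
Proof.
move=> Xy yx; have [p [pmin puniq]] := Xproj x.
have <- : p = y.
  apply: puniq; split => // z /(proj_le x) xz.
  by rewrite lee_fin (le_trans yx).
by apply: puniq; exact: xgetI pmin.
Qed.

(** The projection of a limit point x is no farther from x than any point of X, so its distance to x
    is zero. *)
Lemma proj_well_defined_closed : closed X.
Proof.
move=> x clx; suff -> : x = proj X x by exact: proj_in.
suff h : enorm (proj X x - x) <= 0 by apply/esym/subr0_eq/enorm0_eq0.
apply/ler_addgt0Pr => e e0; rewrite add0r.
have [|z [Xz xz]] := clx [set v | enorm (x - v) < e]; first exact: enorm_nbhs e0 _.
by apply: le_trans (proj_le x Xz) _; rewrite enormB ltW.
Qed.

(** By uniqueness of the projection and compactness, the points of X at distance at least e from p
    are farther from x than p by a positive margin. Such a point cannot be the projection of a v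
    close enough to x. *)
Lemma proj_continuous : compact X -> continuous (proj X).
Proof.
move=> cX; apply: enorm_continuous => x e e0; pose p := proj X x.
pose K := X `&` [set y | e <= enorm (y - p)].
have cont_dist (z : V) : continuous (fun y : V => enorm (y - z)).
  by apply: continuous_enorm; exact: continuous_subr.
have [K0|/set0P K0] := eqVneq K set0.
  exists 1 => // v _; rewrite ltNge enormB; apply/negP => pe.
  have : K (proj X v) by split => //; exact: proj_in.
  by rewrite K0.
have cK : compact K.
  apply: compact_closedI => //.
  by apply: (@preimage_closed _ _ _ [set t | e <= t] (fun y _ => cont_dist p y));
    exact: closed_ge.
have [|y Ky ymin] := @compact_EVT_min V R (fun y : V => enorm (y - x)) K K0 cK.
  by apply: continuous_subspaceT; exact: cont_dist x.
have [Xy yp] := set_mem Ky.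
have gap : enorm (p - x) < enorm (y - x).
  rewrite ltNge; apply/negP => /(proj_unique Xy) yE.
  by move: yp; rewrite /= /p -yE subrr /enorm /dot big1 ?sqrtr0 ?leNgt ?e0//
    => i _; rewrite mxE mul0r.
(* Half the margin, because passing from x to v and back costs |x - v| twice. *)
exists ((enorm (y - x) - enorm (p - x)) / 2); first by rewrite divr_gt0// subr_gt0.
move=> v xv; rewrite ltNge enormB; apply/negP => pve.
have pvK : proj X v \in K by apply/mem_set; split => //; exact: proj_in.
have := ymin _ pvK; apply/negP; rewrite -ltNge.
have h1 : enorm (proj X v - x) <= enorm (proj X v - v) + enorm (x - v).
  by rewrite (enormB x v) -[X in enorm X <= _](subrKA v) enormD.
have h2 : enorm (p - v) <= enorm (p - x) + enorm (x - v).
  by rewrite -[X in enorm X <= _](subrKA x) enormD.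
have h3 := proj_le v (proj_in x).
move: gap xv h1 h2 h3; rewrite -/p.
move: (enorm (p - x)) (enorm (y - x)) (enorm (x - v)) (enorm (proj X v - v)).
move: (enorm (p - v)) (enorm (proj X v - x)); clear=> *; lra.
Qed.

End Projection.

(** * One step of the energy estimate *)

Section VIFacts.
Context {R : realType} {d : nat}.
Local Notation V := 'rV[R]_d.
Variables (F : V -> V) (r : V -> \bar R).
Hypothesis r_proper : proper_fun r.
Local Notation X := (VI_solutions F r).

Lemma VI_fin_num x : X x -> r x \is a fin_num.
Proof.
move=> Xx; have [rNy [z rz]] := r_proper; rewrite fin_numE rNy /=.
apply/negP => /eqP rx; have := Xx z; rewrite rx -(fineK rz) -EFinD /=.
by rewrite leNgt ltNyr.
Qed.

Lemma VI_le x u : X x -> r u \is a fin_num ->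
  0 <= dot (F x) (u - x) + fine (r u) - fine (r x).
Proof.
move=> Xx ru; have := Xx u.
by rewrite -{1}(fineK ru) -{1}(fineK (VI_fin_num Xx)) => h; rewrite -lee_fin.
Qed.

(** The variational inequality at a solution x is itself an affine lower bound of r, with slope
    -F(x). It supplies the coercivity needed for the prox to exist. *)
Lemma VI_minorant : X !=set0 ->
  exists (c : R) (g : V), forall y, ((c + dot g y)%:E <= r y)%E.
Proof.
move=> [x Xx]; exists (fine (r x) + dot (F x) x), (- F x) => y.
have [rNy _] := r_proper.
have [ry|] := boolP (r y \is a fin_num).
  have := VI_le Xx ry; rewrite dotDr dotNr dotNl -(fineK ry) lee_fin; lra.
by rewrite fin_numE rNy /= negbK => /eqP ->; rewrite leey.
Qed.

End VIFacts.

(** Jensen's inequality for uniform weights. The mean starts at index 1 because r may be infinite at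
    the initial point. *)
Lemma econvex_mean (R : realType) (d : nat) (r : 'rV[R]_d -> \bar R)
    (x : nat -> 'rV[R]_d) (K : nat) :
  econvex_fun r -> (forall k, r (x k.+1) \is a fin_num) -> (0 < K)%N ->
  (r (K%:R^-1 *: \sum_(1 <= k < K.+1) x k)
    <= (K%:R^-1 * \sum_(1 <= k < K.+1) fine (r (x k)))%:E)%E.
Proof.
move=> rconv rx; elim: K => // -[_ _|K IH _].
  by rewrite !big_nat1 invr1 scale1r mul1r fineK.
rewrite !(big_nat_recr K.+2)//=.
set s := \sum_(1 <= k < K.+2) x k; set q := \sum_(1 <= k < K.+2) fine (r (x k)).
(* The mean of K + 2 points is the combination, with weights t and 1 - t, of the mean of the first K
   + 1 and the last point. *)
pose t : R := K.+1%:R / K.+2%:R.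
have K1 : K.+1%:R != 0 :> R by rewrite pnatr_eq0.
have K2 : K.+2%:R != 0 :> R by rewrite pnatr_eq0.
have t1 : 1 - t = K.+2%:R^-1 
  by rewrite /t -{1}(divff K2) -mulrBl -[in X in X - _]natr1 addrAC subrr add0r mul1r.
have tK : t * K.+1%:R^-1 = K.+2%:R^-1 by rewrite /t mulrAC divff// mul1r.
have t01 : 0 <= t <= 1.
  by rewrite divr_ge0//= ler_pdivrMr ?ltr0n// mul1r ler_nat.
move: t t1 tK t01 => t t1 tK t01.
have := rconv (K.+1%:R^-1 *: s) (x K.+2) t t01.
rewrite scalerA tK t1 -scalerDr => /le_trans; apply.
rewrite mulrDr EFinD -(fineK (rx K.+1)) EFinM leeD//.
rewrite -tK -EFinM -mulrA EFinM; apply: lee_wpmul2l; last exact: IH.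
by rewrite lee_fin; case/andP: t01.
Qed.

Section OneStep.
Context {R : realType} {d : nat}.
Local Notation V := 'rV[R]_d.
Implicit Types (x y u p g : V).

(** Three-point identity for the prox inequality at u; the leftover 2 gamma <g, x - x'> - |x - x'|^2
    is at most gamma^2 |g|^2. *)
Lemma prox_step_descent (gamma U Q : R) x x' u g :
  dot (x - gamma *: g - x') (u - x') <= gamma * (U - Q) ->
  2 * gamma * (Q - U) + dot (x' - u) (x' - u)
    <= dot (x - u) (x - u) + 2 * gamma * dot g (u - x) + gamma ^+ 2 * dot g g.
Proof.
have := dot_ge0 (x - x' - gamma *: g); rewrite !dotE.
rewrite (dotC x' x) (dotC g x) (dotC g x') (dotC u x) (dotC u x') (dotC g u).
move=> *; nra.
Qed.

(** The same computation at a solution p: adding the variational inequality at p cancels the values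
    of r and replaces g by g - F(p). *)
Lemma prox_step_contract (gamma Q Q' : R) x x' p g Fp :
  dot (x - gamma *: g - x') (p - x') <= gamma * (Q - Q') ->
  0 <= gamma -> 0 <= dot Fp (x' - p) + Q' - Q ->
  dot (x' - p) (x' - p) <= dot (x - p) (x - p) - 2 * gamma * dot (g - Fp) (x - p)
    + gamma ^+ 2 * dot (g - Fp) (g - Fp).
Proof.
move=> h1 g0 /(mulr_ge0 g0); move: h1.
have := dot_ge0 (x - x' - gamma *: (g - Fp)); rewrite !dotE.
rewrite (dotC x' x) (dotC g x) (dotC g x') (dotC p x) (dotC p x') (dotC g p).
rewrite (dotC Fp x) (dotC Fp x') (dotC Fp p) (dotC Fp g).
move=> *; nra.
Qed.

(** The sum of the descent at u, lam times the contraction at p, and the exact expansion of the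
    ghost step. The noise terms <M, x - u> and -<M, y - u> combine into <M, x - y>, which is free of
    u. The multiples 2, 1 and lam of gamma^2 |g - F(p)|^2 come from |g|^2, |M|^2 and the
    contraction; splitting g - F(p) at [gp] doubles 3 + lam. *)
Lemma one_step_energy (gamma lam U Q Q' Phi : R) x x' y p u g gp Fx Fp Fu
    (M := Fx - g) (y' := y - gamma *: M) :
  0 <= gamma -> 0 <= lam ->
  dot (x - gamma *: g - x') (u - x') <= gamma * (U - Q') ->
  dot (x - gamma *: g - x') (p - x') <= gamma * (Q - Q') ->
  0 <= dot Fp (x' - p) + Q' - Q ->
  0 <= dot (Fx - Fu) (x - u) ->
  dot Fp Fp <= Phi ->
  2 * gamma * (dot Fu (x' - u) + Q' - U) - 2 * gamma * dot Fu (x' - x)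
    + dot (x' - u) (x' - u) + dot (y' - u) (y' - u) + lam * dot (x' - p) (x' - p)
  <= dot (x - u) (x - u) + dot (y - u) (y - u) + lam * dot (x - p) (x - p)
    + (dot M ((2 * gamma) *: (x - y) + (2 * gamma ^+ 2) *: (Fx - Fp)
              + (2 * lam * gamma) *: (x - p))
       + 2 * (3 + lam) * gamma ^+ 2
           * (dot (g - gp) (g - gp) + dot (gp - Fp) (gp - Fp))
       - 2 * lam * gamma * dot (Fx - Fp) (x - p) + 2 * gamma ^+ 2 * Phi).
Proof.
move=> g0 lam0 h1 h3 h4 h2 h5.
have {h1} A := prox_step_descent h1.
have {h3 h4} C := prox_step_contract h3 g0 h4.
have yE : dot (y' - u) (y' - u) =
    dot (y - u) (y - u) - 2 * gamma * dot M (y - u) + gamma ^+ 2 * dot M M.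
  have -> : y' - u = (y - u) - gamma *: M by rewrite /y' addrAC.
  by rewrite (dotDl (y - u)) 2!(dotDr _ (y - u)) !dotNl !dotNr !dotZl !dotZr
    (dotC (y - u) M); ring.
have D : dot g g <= 2 * (dot (g - Fp) (g - Fp) + Phi).
  have := dotD_le2 (g - Fp) Fp; rewrite subrK; lra.
have G : dot (g - Fp) (g - Fp) <= 2 * (dot (g - gp) (g - gp) + dot (gp - Fp) (gp - Fp)).
  by have := dotD_le2 (g - gp) (gp - Fp); rewrite subrKA.
(* The correction is linear in M, so it will vanish in mean, and |M|^2 costs only one multiple of |g
   - F(p)|^2. *)
have E : dot M M <= dot (g - Fp) (g - Fp) + 2 * dot M (Fx - Fp).
  have := dot_ge0 (Fx - Fp); have -> : g - Fp = (Fx - Fp) - M.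
    by apply/rowP => i; rewrite !mxE; ring.
  rewrite (dotDl (Fx - Fp) (- M)) !(dotDr _ (Fx - Fp) (- M)) !dotNl !dotNr.
  by rewrite (dotC (Fx - Fp) M); lra.
have h2' : 0 <= dot Fx (x - u) - dot Fu (x - u) by rewrite -dotNl -dotDl.
have FuE : dot Fu (x - u) = dot Fu (x' - u) - dot Fu (x' - x).
  by rewrite -dotNr -dotDr; congr (dot _ _); apply/rowP => i; rewrite !mxE; ring.
have gE : dot g (u - x) = dot M (x - u) - dot Fx (x - u).
  by rewrite -dotNl -dotDl /M addrAC subrr add0r dotNl -dotNr opprB.
have ME : dot M (x - y) = dot M (x - u) - dot M (y - u).
  by rewrite -dotNr -dotDr; congr (dot _ _); apply/rowP => i; rewrite !mxE; ring.
have CE : dot (g - Fp) (x - p) = dot (Fx - Fp) (x - p) - dot M (x - p).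
  rewrite -dotNl -dotDl; congr (dot _ _); rewrite /M.
  by apply/rowP => i; rewrite !mxE; ring.
have vE : dot M ((2 * gamma) *: (x - y) + (2 * gamma ^+ 2) *: (Fx - Fp)
      + (2 * lam * gamma) *: (x - p)) = 2 * gamma * (dot M (x - u) - dot M (y - u))
      + 2 * gamma ^+ 2 * dot M (Fx - Fp) + 2 * lam * gamma * dot M (x - p).
  by rewrite (dotDr M (_ + _)) (dotDr M (_ *: _)) !dotZr ME.
rewrite vE yE; move: A C; rewrite gE CE => A C.
have g2 : 0 <= gamma ^+ 2 by exact: sqr_ge0.
have C' := ler_wpM2l lam0 C.
have D' := ler_wpM2l g2 D.
have E' := ler_wpM2l g2 E.
have G' := ler_wpM2l (mulr_ge0 (addr_ge0 (ler0n _ 3) lam0) g2) G.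
have H' := mulr_ge0 g0 h2'.
move: A C' D' E' G' H' FuE; clear.
move: (dot M M) (dot g g) => MM gg.
move: (dot (g - Fp) (g - Fp)) (dot (g - gp) (g - gp)) (dot (gp - Fp) (gp - Fp)).
move: (dot M (Fx - Fp)) (dot M (x - p)) (dot M (x - u)) (dot M (y - u)).
move: (dot Fx (x - u)) (dot (Fx - Fp) (x - p)) (dot (x' - p) (x' - p)).
move: (dot (x - p) (x - p)) (dot (x' - u) (x' - u)) (dot (x - u) (x - u)).
move: (dot Fu (x' - u)) (dot Fu (x' - x)) (dot Fu (x - u)) (dot (y - u) (y - u)).
move=> *; nra.
Qed.

End OneStep.

(** * Pathwise bound of the gap *)

Section SgdaPath.
Context {R : realType} {d : nat} {dXi : measure_display} {Xi : measurableType dXi}.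
Local Notation V := 'rV[R]_d.
Local Notation B := (borel_rV R d).
Variables (F : V -> V) (Fxi : Xi -> V -> V) (r : V -> \bar R).
Variables (gamma lam Phi c : R) (x0 : V).
Local Notation X := (VI_solutions F r).
Local Notation p := (proj X).

(* The bound H of the increase of the energy in one step; [a] is the sample. *)
Definition energy_increment (a : Xi) (x y : V) : R :=
  dot (F x - Fxi a x) ((2 * gamma) *: (x - y)
      + (2 * gamma ^+ 2) *: (F x - F (p x)) + (2 * lam * gamma) *: (x - p x))
  + 2 * (3 + lam) * gamma ^+ 2
      * (dot (Fxi a x - Fxi a (p x)) (Fxi a x - Fxi a (p x))
         + dot (Fxi a (p x) - F (p x)) (Fxi a (p x) - F (p x)))
  - 2 * lam * gamma * dot (F x - F (p x)) (x - p x) + 2 * gamma ^+ 2 * Phi.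

(* The state consists of the iterate, the ghost iterate and the running bound
   of the energy. *)
Definition sgda_step (q : Xi * (B * B * R)) : B * B * R :=
  let: (a, (x, y, t)) := q in
  (prox gamma r (x - gamma *: Fxi a x), y - gamma *: (F x - Fxi a x),
   t + energy_increment a x y).

Local Notation state := (process sgda_step ((x0 : B), (x0 : B), c)).

Lemma sgda_process (dO : measure_display) (Om : measurableType dO)
    (xi : nat -> Om -> Xi) k w :
  sgda r Fxi gamma x0 xi k w = (state (xi ^~ w) k).1.1.
Proof. by elim: k => //= k ->; case: (process _ _ _ k) => -[]. Qed.

Hypotheses (r_proper : proper_fun r) (r_lsc : lower_semicontinuous r).
Hypotheses (r_convex : econvex_fun r) (X0 : X !=set0).
Hypothesis Xproj : proj_well_defined X.
Hypothesis F_mono : monotone_op F.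
Hypotheses (gamma_gt0 : 0 < gamma) (lam_ge0 : 0 <= lam).
Hypothesis FPhi : forall y, X y -> dot (F y) (F y) <= Phi.

Variable xs : nat -> Xi.
Local Notation x k := ((state xs k).1.1 : V).
Local Notation y k := ((state xs k).1.2 : V).
Local Notation t k := (state xs k).2.

Lemma path_xS k : x k.+1 = prox gamma r (x k - gamma *: Fxi (xs k) (x k)).
Proof. by rewrite /=; case: (process _ _ _ k) => -[]. Qed.

Lemma path_yS k : y k.+1 = y k - gamma *: (F (x k) - Fxi (xs k) (x k)).
Proof. by rewrite /=; case: (process _ _ _ k) => -[]. Qed.

Lemma path_tS k : t k.+1 = t k + energy_increment (xs k) (x k) (y k).
Proof. by rewrite /=; case: (process _ _ _ k) => -[]. Qed.

Lemma path_fin_num k : r (x k.+1) \is a fin_num.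
Proof. by rewrite path_xS; apply: prox_fin_num => //; exact: (VI_minorant r_proper X0). Qed.

(** Induction on k with the one-step estimate. The factor 2 in front of |x_0 - u|^2 is there because
    the iterate and the ghost sequence both start at x_0. *)
Lemma path_energy u k : r u \is a fin_num ->
  2 * gamma * \sum_(1 <= j < k.+1)
      (dot (F u) (x j - u) + fine (r (x j)) - fine (r u))
    - 2 * gamma * dot (F u) (x k - x0)
    + dot (x k - u) (x k - u) + dot (y k - u) (y k - u)
    + lam * dot (x k - p (x k)) (x k - p (x k))
  <= 2 * dot (x0 - u) (x0 - u) + lam * dot (x0 - p x0) (x0 - p x0) + (t k - c).
Proof.
move=> ru; elim: k => [|k IH].
  rewrite big_geq//= !subrr.
  have -> : dot (F u) 0 = 0 by rewrite /dot big1// => i _; rewrite mxE mulr0.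
  lra.
have rminor := VI_minorant r_proper X0.
have Xp : X (p (x k)) by exact: (proj_in Xproj).
have rp := VI_fin_num r_proper Xp.
have rx' := path_fin_num k.
have := prox_le r_proper r_lsc r_convex gamma_gt0 rminor
  (x k - gamma *: Fxi (xs k) (x k)) ru.
have := prox_le r_proper r_lsc r_convex gamma_gt0 rminor
  (x k - gamma *: Fxi (xs k) (x k)) rp.
rewrite -path_xS => hp hu.
have hV := VI_le r_proper Xp rx'.
have step := one_step_energy (y k) (Fxi (xs k) (p (x k))) (ltW gamma_gt0) lam_ge0
  hu hp hV (F_mono (x k) u) (FPhi Xp).
rewrite -path_yS -/(energy_increment (xs k) (x k) (y k)) in step.
(* The one-step estimate measures x_(k+1) from the old projection p(x_k); passing to its own
   projection can only decrease the distance. *)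
have dproj : dot (x k.+1 - p (x k.+1)) (x k.+1 - p (x k.+1)) <=
       dot (x k.+1 - p (x k)) (x k.+1 - p (x k)).
  have := proj_le Xproj (x k.+1) Xp.
  by rewrite enormB (enormB (p (x k))) le_enorm.
have {}dproj := ler_wpM2l lam_ge0 dproj.
rewrite big_nat_recr// path_tS.
(* Monotonicity yields <F(u), x_k - u>, whereas the sum contains <F(u), x_(k+1) - u>; these shifts
   telescope to <F(u), x_(k+1) - x_0>. *)
have -> : dot (F u) (x k.+1 - x0) =
    dot (F u) (x k.+1 - x k) + dot (F u) (x k - x0).
  by rewrite -dotDr subrKA.
move: IH step dproj; move: (proj X) => pr; clear.
set S := \sum_(1 <= j < k.+1) _; move: S => S.
move: (energy_increment _ _ _) (t k) (dot (F u) (x k.+1 - u)).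
move: (fine (r u)) (fine (r (x k.+1))).
move: (dot (F u) (x k.+1 - x k)) (dot (F u) (x k - x0)).
move: (x k.+1) (y k.+1) (x k) (y k) => x' y' x y.
move: (dot (x' - pr x') _) (dot (x' - pr x) _) (dot (x - pr x) _) (dot (x0 - pr x0) _).
move: (dot (x' - u) _) (dot (y' - u) _) (dot (x - u) _) (dot (y - u) _) (dot (x0 - u) _).
clear=> /= *; lra.
Qed.
End SgdaPath.

(** With a the difference of the values of F and b that of the points, star-cocoercivity and Young's
    inequality with weight 1 / ell give 2 |a|^2 <= 2 ell <a, b> <= |a|^2 + ell^2 |b|^2. *)
Lemma star_cocoercive_lipschitz (R : realType) (d : nat) (X : set 'rV[R]_d)
    (F : 'rV[R]_d -> 'rV[R]_d) (ell : R) u :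
  0 < ell -> star_cocoercive X F ell ->
  dot (F u - F (proj X u)) (F u - F (proj X u))
    <= ell ^+ 2 * dot (u - proj X u) (u - proj X u).
Proof.
move=> ell0 /(_ u); rewrite enorm2E.
set a := F u - _; set b := u - _; move: a b => a b h.
have := dot_le_young a b (divr_gt0 ltr01 ell0); rewrite div1r invrK => h2.
have := ler_wpM2l (ltW ell0) h2; rewrite mulrDr (mulrA ell ell^-1) mulfV ?gt_eqF// mul1r.
nra.
Qed.

Lemma Gap_ge0 (R : realType) (d : nat) (F : 'rV[R]_d -> 'rV[R]_d)
    (r : 'rV[R]_d -> \bar R) (C : set 'rV[R]_d) z :
  VI_solutions F r !=set0 -> VI_solutions F r `<=` C -> (0 <= Gap F r C z)%E.
Proof.
move=> [u Xu] XC; apply: le_trans (Xu z) _; apply: ereal_sup_ubound.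
by exists u => //; exact: XC.
Qed.

Section SgdaGap.
Context {R : realType} {d : nat} {dXi : measure_display} {Xi : measurableType dXi}.
Local Notation V := 'rV[R]_d.
Local Notation B := (borel_rV R d).
Variables (F : V -> V) (Fxi : Xi -> V -> V) (r : V -> \bar R) (C : set V).
Variables (gamma lam Phi c ell D2 diam : R) (x0 : V).
Local Notation X := (VI_solutions F r).
Local Notation p := (proj X).
Hypotheses (r_proper : proper_fun r) (r_lsc : lower_semicontinuous r).
Hypotheses (r_convex : econvex_fun r) (X0 : X !=set0).
Hypothesis Xproj : proj_well_defined X.
Hypothesis F_mono : monotone_op F.
Hypotheses (gamma_gt0 : 0 < gamma) (lam_ge0 : 0 <= lam).
Hypothesis FPhi : forall y, X y -> dot (F y) (F y) <= Phi.
Hypotheses (ell_gt0 : 0 < ell) (F_star : star_cocoercive X F ell).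
Hypothesis XC : X `<=` C.
Hypothesis CD2 : forall u, C u -> dot (x0 - u) (x0 - u) <= D2.
Hypothesis Cdiam : forall u v, C u -> C v -> enorm (u - v) <= diam.
Hypothesis cE : c = 3 * D2 + lam * dot (x0 - p x0) (x0 - p x0)
  + 4 * gamma ^+ 2 * ell ^+ 2 * diam ^+ 2 + 4 * gamma ^+ 2 * Phi.
Variable xs : nat -> Xi.
Local Notation state :=
  (process (sgda_step F Fxi r gamma lam Phi) ((x0 : B), (x0 : B), c)).
Local Notation x k := ((state xs k).1.1 : V).
Local Notation y k := ((state xs k).1.2 : V).
Local Notation t k := (state xs k).2.

(** Compare F(u) with F at the projection of u onto X*, which also lies in C and hence within [diam]
    of u. *)
Lemma norm_F_le u : C u -> dot (F u) (F u) <= 2 * (ell ^+ 2 * diam ^+ 2 + Phi).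
Proof.
move=> Cu; have Xp := proj_in Xproj u.
have h := dotD_le2 (F u - F (p u)) (F (p u)); rewrite subrK in h.
apply: (le_trans h); rewrite ler_pM2l ?ltr0n//; apply: lerD; last exact: FPhi.
apply: le_trans (star_cocoercive_lipschitz u ell_gt0 F_star) _.
rewrite ler_wpM2l ?sqr_ge0// -enorm2E lerXn2r ?nnegrE ?enorm_ge0//.
  by apply: le_trans (enorm_ge0 (u - p u)) _; apply: Cdiam => //; exact: XC.
by apply: Cdiam => //; exact: XC.
Qed.

(** The correction 2 gamma <F(u), x_k - x_0> is split at u and each half bounded by Young's
    inequality. One half is absorbed by |x_k - u|^2, the other raises 2 |x_0 - u|^2 to 3 |x_0 -
    u|^2, and the two terms gamma^2 |F(u)|^2 give the last two summands of [c]. *)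
Lemma path_gap u k : C u -> r u \is a fin_num ->
  2 * gamma * \sum_(1 <= j < k.+1)
      (dot (F u) (x j - u) + fine (r (x j)) - fine (r u)) <= t k.
Proof.
move=> Cu ru.
have := path_energy Fxi c x0 r_proper r_lsc r_convex X0 Xproj F_mono gamma_gt0
  lam_ge0 FPhi xs k ru.
have hc := cE; have hF := norm_F_le Cu; have hD := CD2 Cu.
have h1 := dot_young (gamma *: F u) (x k - u).
have h2 := dot_young (gamma *: F u) (u - x0).
have -> : dot (F u) (x k - x0) = dot (F u) (x k - u) + dot (F u) (u - x0).
  by rewrite -dotDr subrKA.
have hs := dot_ge0 (y k - u).
have hp := mulr_ge0 lam_ge0 (dot_ge0 (x k - p (x k))).
move: h1 h2; rewrite !dotZl !dotZr.
have -> : dot (u - x0) (u - x0) = dot (x0 - u) (x0 - u).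
  by rewrite -opprB dotNl dotNr opprK.
have hF' := ler_wpM2l (sqr_ge0 gamma) hF.
move: hc hF' hD hs hp.
move: (t k) (\sum_(1 <= j < k.+1) _) => tk S.
move: (x k) (y k) (p) => xk yk pr.
move: (dot (F u) (F u)) (dot (F u) (xk - u)) (dot (F u) (u - x0)) (dot (x0 - u) _).
move: (dot (xk - u) _) (dot (yk - u) _) (dot (xk - pr xk) _) (dot (x0 - pr x0) _).
move=> {}*; lra.
Qed.

(** For u a solution, every summand of the gap sum is nonnegative by the variational inequality. *)
Lemma path_t_ge0 k : 0 <= t k.
Proof.
have [u Xu] := X0; have ru := VI_fin_num r_proper Xu.
apply: le_trans (path_gap k (XC Xu) ru); apply: mulr_ge0.
  by rewrite mulr_ge0// ltW.
rewrite big_nat; apply: sumr_ge0 => j /andP[j0 _].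
apply: VI_le => //; rewrite -(prednK j0).
exact: (path_fin_num Fxi lam Phi c x0 r_proper r_lsc X0 gamma_gt0).
Qed.

Lemma path_Gap K : (0 < K)%N ->
  (Gap F r C (K%:R^-1 *: \sum_(1 <= k < K.+1) x k)
    <= (t K / (2 * gamma * K%:R))%:E)%E.
Proof.
move=> K0; apply: ge_ereal_sup => _ [u Cu <-]; set z := _ *: _.
have [rNy _] := r_proper.
(* A point with r u = +oo contributes -oo to the supremum. *)
have [ru|] := boolP (r u \is a fin_num); last first.
  by rewrite fin_numE rNy /= negbK => /eqP ->; rewrite addeNy// leNye.
have rx := path_fin_num Fxi lam Phi c x0 r_proper r_lsc X0 gamma_gt0 xs.
have rz := econvex_mean (x := fun k => x k) r_convex rx K0.
rewrite -/z in rz.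
set q := K%:R^-1 * _ in rz.
apply: (@le_trans _ _ ((dot (F u) (z - u))%:E + q%:E - r u)%E).
  by rewrite leeD2r// leeD2l.
rewrite -(fineK ru).
suff h : dot (F u) (z - u) + q - fine (r u) <= t K / (2 * gamma * K%:R).
  by move: h; rewrite -lee_fin.
have K0' : 0 < K%:R :> R by rewrite ltr0n.
rewrite ler_pdivlMr ?mulr_gt0//; apply: le_trans (path_gap K Cu ru).
rewrite sumrB big_split /=.
under [X in _ <= _ * (X + _ - _)]eq_bigr do rewrite dotDr dotNr.
rewrite sumrB -dot_sumr !sumr_const_nat subn1 /=.
rewrite /z /q dotDr dotNr dotZr.
move: (\sum_(1 <= _ < _) fine _) (dot (F u) (\sum_(1 <= _ < _) _)) => a b.
rewrite -(mulr_natl (dot (F u) u)) -(mulr_natl (fine (r u))).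
move: (dot (F u) u) (fine (r u)) => e f.
have K1 : K%:R != 0 :> R by rewrite gt_eqF.
by rewrite le_eqVlt; apply/orP; left; apply/eqP; field.
Qed.

End SgdaGap.

(** * Expectations *)

(* Unlike [ge0_le_integral], no measurability: the gap of a random point is a
   supremum over an uncountable set. *)
Lemma ge0_le_integral_total d (T : measurableType d) (R : realType)
    (mu : {measure set T -> \bar R}) (f g : T -> \bar R) :
  (forall x, (0 <= f x)%E) -> (forall x, (f x <= g x)%E) ->
  (\int[mu]_x f x <= \int[mu]_x g x)%E.
Proof.
move=> f0 fg; have g0 x : (0 <= g x)%E := le_trans (f0 x) (fg x).
rewrite !ge0_integralTE//; apply: ge_ereal_sup => _ [h hf <-].
apply: ereal_sup_ubound; exists h => // x; exact: le_trans (fg x).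
Qed.

(** The bounds on the integrals of the nonnegative [Q1] and [Q2] make them integrable, so linearity
    of the integral applies and the mean-zero term drops out. *)
Lemma integral_affine_le d (T : measurableType d) (R : realType)
    (D : probability T R) (N Q1 Q2 : T -> R) (k0 kappa q1 q2 : R) :
  D.-integrable setT (EFin \o N) -> (\int[D]_a (N a)%:E = 0)%E ->
  measurable_fun setT Q1 -> measurable_fun setT Q2 ->
  (forall a, 0 <= Q1 a) -> (forall a, 0 <= Q2 a) ->
  (\int[D]_a (Q1 a)%:E <= q1%:E)%E -> (\int[D]_a (Q2 a)%:E <= q2%:E)%E ->
  0 <= kappa ->
  (\int[D]_a (k0 + N a + kappa * (Q1 a + Q2 a))%:E
    <= (k0 + kappa * (q1 + q2))%:E)%E.
Proof.
move=> iN N0 mQ1 mQ2 Q1_0 Q2_0 Q1q Q2q kappa0.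
have iQ (Q : T -> R) q : measurable_fun setT Q -> (forall a, 0 <= Q a) ->
    (\int[D]_a (Q a)%:E <= q%:E)%E -> D.-integrable setT (EFin \o Q).
  move=> mQ Q0 Qq; apply/integrableP; split; first exact/measurable_EFinP.
  under eq_integral do rewrite /= ger0_norm//.
  by apply: le_lt_trans Qq _; exact: ltry.
have iQ1 := iQ _ _ mQ1 Q1_0 Q1q; have iQ2 := iQ _ _ mQ2 Q2_0 Q2q.
have ik0 : D.-integrable setT (EFin \o cst k0).
  exact: finite_measure_integrable_cst.
have iQ12 := integrableD measurableT iQ1 iQ2.
have ik0N := integrableD measurableT ik0 iN.
have ikQ := integrableZl measurableT kappa iQ12.
rewrite (_ : (fun a => _) = fun a => ((EFin \o cst k0) a + (EFin \o N) a
   + kappa%:E * ((EFin \o Q1) a + (EFin \o Q2) a))%E)//.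
rewrite integralD// integralD// N0 integralZl// integralD//.
have -> : (\int[D]_a (EFin \o cst k0) a = k0%:E)%E.
  by rewrite -(expectation_cst D k0) unlock.
rewrite adde0; by rewrite EFinD EFinM leeD2l// lee_wpmul2l ?lee_fin// EFinD leeD.
Qed.

Section OracleMoments.
Context {R : realType} {d : nat} {dXi : measure_display} {Xi : measurableType dXi}.
Local Notation V := 'rV[R]_d.
Local Notation B := (borel_rV R d).
Variables (D : probability Xi R) (F : V -> V) (Fxi : Xi -> V -> V).
Hypothesis unb : unbiased_oracle D Fxi F.

Lemma integrable_oracle_noise x v :
  D.-integrable setT (EFin \o (fun a => dot (F x - Fxi a x) v)) /\
  (\int[D]_a (dot (F x - Fxi a x) v)%:E = 0)%E.
Proof.
pose f i (a : Xi) : \bar R := ((v 0 i)%:E * ((F x 0 i)%:E - (Fxi a x 0 i)%:E))%E.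
have dotfE a : (dot (F x - Fxi a x) v)%:E = (\sum_i f i a)%E.
  by rewrite /dot -sumEFin; apply: eq_bigr => i _; rewrite !mxE mulrC EFinM EFinB.
have icst i : D.-integrable setT (EFin \o cst (F x 0 i)).
  exact: finite_measure_integrable_cst.
have idiff i : D.-integrable setT (fun a => (F x 0 i)%:E - (Fxi a x 0 i)%:E)%E.
  by apply: (integrableB measurableT (icst i)); have [] := unb x i.
have fi i : D.-integrable setT (f i) by exact: integrableZl.
split.
  rewrite (_ : _ \o _ = fun a => \sum_i f i a)%E; last by apply/funext => a /=.
  exact: integrable_sum.
under eq_integral do rewrite dotfE.
rewrite integral_sum//; apply: big1 => i _.
have [iF EF] := unb x i; rewrite unlock in EF.
rewrite integralZl// (integralB measurableT (icst i) iF) /=.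
have -> : (\int[D]_a (EFin \o cst (F x 0%R i)) a = (F x 0%R i)%:E)%E.
  by rewrite -(expectation_cst D (F x 0 i)) unlock.
by rewrite EF subee// mule0.
Qed.

Variables (r : V -> \bar R) (gamma ellD Phi s : R).
Local Notation X := (VI_solutions F r).
Local Notation p := (proj X).
Hypothesis mFxi : measurable_oracle Fxi.
Hypothesis Xproj : proj_well_defined X.
Hypothesis F_mono : monotone_op F.
Hypothesis coco : expected_cocoercive D Fxi F X ellD.
Hypothesis sigma_s :
  forall y, X y -> ('E_D[fun a => (enorm (Fxi a y - F y) ^+ 2)%R] <= s%:E)%E.
Hypotheses (gamma_gt0 : 0 < gamma) (ellD_gt0 : 0 < ellD).
Hypothesis gamma_le : gamma <= 1 / (2 * ellD).
Let lam := 6 * gamma * ellD.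

Lemma integral_energy_increment (t : R) x y :
  (\int[D]_a (t + energy_increment F Fxi r gamma lam Phi a x y)%:E
    <= (t + (2 * (3 + lam) * gamma ^+ 2 * s + 2 * gamma ^+ 2 * Phi))%:E)%E.
Proof.
have Xp : X (p x) by exact: (proj_in Xproj).
pose aa := dot (F x - F (p x)) (x - p x).
pose v := (2 * gamma) *: (x - y) + (2 * gamma ^+ 2) *: (F x - F (p x))
  + (2 * lam * gamma) *: (x - p x).
have aa0 : 0 <= aa by exact: F_mono.
have ge : gamma * ellD <= 1 / 2.
  by move: gamma_le; rewrite ler_pdivlMr ?mulr_gt0//; lra.
have lam0 : 0 <= lam by rewrite /lam !mulr_ge0// ltW.
pose k0 := t - 2 * lam * gamma * aa + 2 * gamma ^+ 2 * Phi.
pose kappa := 2 * (3 + lam) * gamma ^+ 2.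
have mF z : measurable_fun [set: Xi] (fun a => Fxi a z : B).
  exact: (measurable_comp_oracle (a := id) (x := cst z)).
have mc (z : V) : measurable_fun [set: Xi] (fun=> z : B) by exact: measurable_cst.
have [iN N0] := integrable_oracle_noise x v.
have := @integral_affine_le _ _ _ D (fun a => dot (F x - Fxi a x) v)
  (fun a => dot (Fxi a x - Fxi a (p x)) (Fxi a x - Fxi a (p x)))
  (fun a => dot (Fxi a (p x) - F (p x)) (Fxi a (p x) - F (p x)))
  k0 kappa (ellD * aa) s iN N0.
move=> /(_ _ _ _ _ _ _ _)/le_trans - h.
rewrite (_ : (fun a => _) = fun a => (k0 + dot (F x - Fxi a x) v + kappa *
  (dot (Fxi a x - Fxi a (p x)) (Fxi a x - Fxi a (p x)) +
   dot (Fxi a (p x) - F (p x)) (Fxi a (p x) - F (p x))))%:E); last first.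
  by apply/funext => a; congr EFin; rewrite /energy_increment -/v -/aa /k0 /kappa; ring.
apply: h.
- by apply: measurable_dot; exact: measurable_subr_rV.
- by apply: measurable_dot; exact: measurable_subr_rV.
- by move=> a; exact: dot_ge0.
- by move=> a; exact: dot_ge0.
- by have := coco x; rewrite unlock; under eq_integral do rewrite enorm2E.
- by have := sigma_s Xp; rewrite unlock; under eq_integral do rewrite enorm2E.
- by rewrite /kappa mulr_ge0 ?sqr_ge0// mulr_ge0// addr_ge0.
rewrite lee_fin /k0 /kappa.
have g2 := ler_wpM2l (mulr_ge0 (ltW gamma_gt0) aa0) ge.
have ge0 : 0 <= gamma * ellD by rewrite mulr_ge0// ltW.
(* With lam = 6 gamma ellD, the total coefficient of [aa] is 2 (3 + lam) gamma^2 ellD - 2 lam gamma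
   = -12 gamma (gamma ellD) (1/2 - gamma ellD), nonpositive by the step size condition. *)
suff : 0 <= gamma * aa * (gamma * ellD) * (1 / 2 - gamma * ellD).
  by rewrite /lam; nra.
by rewrite !mulr_ge0// ?subr_ge0// ltW.
Qed.

Lemma measurable_energy_increment (c' : R) (mp : measurable_fun [set: B] (p : B -> B)) :
  measurable_fun [set: Xi * (B * B * R)] (fun q : Xi * (B * B * R) =>
    energy_increment F Fxi r gamma c' Phi q.1 q.2.1.1 q.2.1.2).
Proof.
have mF : measurable_fun [set: B] (F : B -> B) by exact: measurable_mean_oracle mFxi unb.
have ma : measurable_fun [set: Xi * (B * B * R)] fst by exact: measurable_fst.
have mxy : measurable_fun [set: Xi * (B * B * R)] (fun q => q.2.1).
  exact: (measurableT_comp measurable_fst measurable_snd).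
have mx : measurable_fun [set: Xi * (B * B * R)] (fun q => q.2.1.1).
  exact: (measurableT_comp measurable_fst mxy).
have my : measurable_fun [set: Xi * (B * B * R)] (fun q => q.2.1.2).
  exact: (measurableT_comp measurable_snd mxy).
have mpx := measurableT_comp mp mx.
have mFx := measurableT_comp mF mx.
have mFpx := measurableT_comp mF mpx.
have mFxx := measurable_comp_oracle mFxi ma mx.
have mFxp := measurable_comp_oracle mFxi ma mpx.
rewrite /energy_increment.
apply: measurable_funD => //; apply: measurable_funB.
  apply: measurable_funD.
    apply: measurable_dot; first exact: measurable_subr_rV.
    apply: measurable_addr_rV; first apply: measurable_addr_rV;
      by apply: measurable_scaler_rV; exact: measurable_subr_rV.
  apply: measurable_funM => //; apply: measurable_funD;
    by apply: measurable_dot; exact: measurable_subr_rV.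
apply: measurable_funM => //.
by apply: measurable_dot; exact: measurable_subr_rV.
Qed.

End OracleMoments.

Section ExpectedGap.
Context {R : realType} {d : nat} {dXi dO : measure_display}.
Context {Xi : measurableType dXi} {Om : measurableType dO}.
Local Notation V := 'rV[R]_d.
Local Notation B := (borel_rV R d).
Variables (D : probability Xi R) (P : probability Om R).
Variables (F : V -> V) (Fxi : Xi -> V -> V) (r : V -> \bar R) (C : set V).
Variables (ell ellD gamma Phi s D2 diam : R) (x0 : V).
Variable xi : nat -> {RV P >-> Xi}.
Local Notation X := (VI_solutions F r).
Local Notation p := (proj X).
Hypotheses (mFxi : measurable_oracle Fxi) (unb : unbiased_oracle D Fxi F).
Hypotheses (r_proper : proper_fun r) (r_lsc : lower_semicontinuous r).
Hypotheses (r_convex : econvex_fun r) (X0 : X !=set0).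
Hypothesis Xproj : proj_well_defined X.
Hypothesis iid : iid_samples D xi.
Hypothesis F_mono : monotone_op F.
Hypotheses (ell_gt0 : 0 < ell) (F_star : star_cocoercive X F ell).
Hypotheses (cC : compact C) (XC : X `<=` C).
Hypothesis coco : expected_cocoercive D Fxi F X ellD.
Hypotheses (gamma_gt0 : 0 < gamma) (ellD_gt0 : 0 < ellD).
Hypothesis gamma_le : gamma <= 1 / (2 * ellD).
Hypothesis FPhi : forall y, X y -> dot (F y) (F y) <= Phi.
Hypothesis CD2 : forall u, C u -> dot (x0 - u) (x0 - u) <= D2.
Hypothesis Cdiam : forall u v, C u -> C v -> enorm (u - v) <= diam.
Hypothesis sigma_s :
  forall y, X y -> ('E_D[fun a => (enorm (Fxi a y - F y) ^+ 2)%R] <= s%:E)%E.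

Let lam := 6 * gamma * ellD.
Let c := 3 * D2 + lam * dot (x0 - p x0) (x0 - p x0)
  + 4 * gamma ^+ 2 * ell ^+ 2 * diam ^+ 2 + 4 * gamma ^+ 2 * Phi.
Let b := 2 * (3 + lam) * gamma ^+ 2 * s + 2 * gamma ^+ 2 * Phi.
Let incr (q : Xi * (B * B * R)) : R :=
  energy_increment F Fxi r gamma lam Phi q.1 q.2.1.1 q.2.1.2.
Let step := sgda_step F Fxi r gamma lam Phi.
Local Notation Z k w := (process step ((x0 : B), (x0 : B), c) (xi ^~ w) k).

Let lam_ge0 : 0 <= lam.
Proof. by rewrite /lam !mulr_ge0// ltW. Qed.

Lemma measurable_proj : measurable_fun [set: B] (p : B -> B).
Proof.
apply: continuous_measurable_rV; apply: (proj_continuous Xproj).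
exact: subclosed_compact (proj_well_defined_closed Xproj) cC XC.
Qed.

Lemma measurable_sgda_step : measurable_fun setT step.
Proof.
have mF : measurable_fun [set: B] (F : B -> B) by exact: measurable_mean_oracle mFxi unb.
have ma : measurable_fun [set: Xi * (B * B * R)] fst by exact: measurable_fst.
have mxy : measurable_fun [set: Xi * (B * B * R)] (fun q => q.2.1).
  exact: (measurableT_comp measurable_fst measurable_snd).
have mx : measurable_fun [set: Xi * (B * B * R)] (fun q => q.2.1.1).
  exact: (measurableT_comp measurable_fst mxy).
have my : measurable_fun [set: Xi * (B * B * R)] (fun q => q.2.1.2).
  exact: (measurableT_comp measurable_snd mxy).
have mt : measurable_fun [set: Xi * (B * B * R)] (fun q => q.2.2).
  exact: (measurableT_comp measurable_snd measurable_snd).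
have mFx := measurableT_comp mF mx.
have mFxx := measurable_comp_oracle mFxi ma mx.
have mprox : measurable_fun [set: B] (prox gamma r : B -> B).
  by apply: continuous_measurable_rV; apply: prox_continuous => //;
    exact: (VI_minorant r_proper X0).
rewrite (_ : step = fun q : Xi * (B * B * R) =>
  ((prox gamma r ((q.2.1.1 : V) - gamma *: Fxi q.1 q.2.1.1) : B,
    (q.2.1.2 : V) - gamma *: (F q.2.1.1 - Fxi q.1 q.2.1.1) : B),
   q.2.2 + incr q)); last by apply/funext => -[a [[x y] t]].
apply: measurable_fun_pair; first apply: measurable_fun_pair.
- apply: (measurableT_comp mprox); apply: measurable_subr_rV => //.
  exact: measurable_scaler_rV.
- apply: measurable_subr_rV => //; apply: measurable_scaler_rV.
  exact: measurable_subr_rV.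
- apply: measurable_funD => //.
  exact: (measurable_energy_increment unb gamma Phi mFxi lam measurable_proj).
Qed.

Lemma state_ge0 xs k : 0 <= (process step ((x0 : B), (x0 : B), c) xs k).2.
Proof.
exact: (path_t_ge0 Fxi r_proper r_lsc r_convex X0 Xproj F_mono gamma_gt0 lam_ge0
  FPhi ell_gt0 F_star XC CD2 Cdiam (erefl c)).
Qed.

Lemma expected_state k : (\int[P]_w ((Z k w).2)%:E <= (c + k%:R * b)%:E)%E.
Proof.
elim: k => [|k IH] /=.
  rewrite mul0r addr0 -[leLHS](_ : 'E_P[cst c] = _)%E; last by rewrite unlock.
  by rewrite expectation_cst.
have b0 : 0 <= b.
  have [u Xu] := X0.
  have Phi0 : 0 <= Phi by apply: le_trans (FPhi Xu); exact: dot_ge0.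
  have s0 : 0 <= s.
    rewrite -lee_fin; apply: le_trans (sigma_s Xu).
    by apply: expectation_ge0 => a; exact: sqr_ge0.
  have g2 : 0 <= gamma ^+ 2 by exact: sqr_ge0.
  have l3 : 0 <= 2 * (3 + lam) by rewrite mulr_ge0// addr_ge0.
  by rewrite /b addr_ge0// mulr_ge0// mulr_ge0.
(* Freezing the past requires an integrand nonnegative at all states, while the updated bound is
   known to be nonnegative only at states reached by some sample path. Truncation at zero repairs
   this and changes nothing at reached states. *)
pose h (q : Xi * (B * B * R)) : \bar R := (Num.max (q.2.2 + incr q) 0)%:E.
have mstep := measurable_sgda_step.
have mt : measurable_fun [set: Xi * (B * B * R)] (fun q => q.2.2).
  exact: (measurableT_comp measurable_snd measurable_snd).
have mh : measurable_fun setT h.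
  apply/measurable_EFinP; apply: measurable_maxr => //; apply: measurable_funD => //.
  exact: (measurable_energy_increment unb gamma Phi mFxi lam measurable_proj).
have h0 q : (0 <= h q)%E by rewrite lee_fin le_max lexx orbT.
have hE w a : h (a, Z k w) = ((Z k w).2 + incr (a, Z k w))%:E.
  (* The state after one more step on a modified sample path is nonnegative. *)
  congr EFin; apply/max_idPl.
  have := state_ge0 (fun j => if j == k then a else xi j w) k.+1.
  rewrite path_tS eqxx.
  rewrite (@eq_process _ _ _ _ _ _ _ (xi ^~ w))// => j jk.
  by rewrite ltn_eqF.
rewrite (_ : (fun w => _) = fun w => h (xi k w, Z k w)); last first.
  apply/funext => w; rewrite hE; congr EFin.
  exact: (path_tS F Fxi r gamma lam Phi c x0 (xi ^~ w) k).
rewrite (integral_process_step iid _ mstep)//.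
have mZ : measurable_fun setT (fun w => Z k w).
  by apply: measurable_process => // j _; exact: measurable_funPT.
apply: (@le_trans _ _ (\int[P]_w (((Z k w).2)%:E + b%:E))%E).
  apply: ge0_le_integral_total => w; first by apply: integral_ge0 => a _.
  under eq_integral do rewrite hE.
  exact: (integral_energy_increment unb Phi mFxi Xproj F_mono coco sigma_s).
rewrite ge0_integralD//.
- rewrite (_ : \int[P]_w b%:E = b%:E)%E; last first.
    by have := expectation_cst P b; rewrite unlock.
  apply: (@le_trans _ _ ((c + k%:R * b)%:E + b%:E)%E); first exact: leeD2r.
  by rewrite -EFinD lee_fin -[k.+1%:R]natr1 mulrDl mul1r (addrA c _ b).
- by move=> w _; rewrite lee_fin; exact: state_ge0.
- by apply/measurable_EFinP; exact: (measurableT_comp measurable_snd mZ).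
Qed.

Lemma expected_Gap K : (0 < K)%N ->
  (\int[P]_w Gap F r C (K%:R^-1 *: \sum_(1 <= k < K.+1) sgda r Fxi gamma x0 xi k w)
    <= ((c + K%:R * b) / (2 * gamma * K%:R))%:E)%E.
Proof.
move=> K0; have K0' : 0 < K%:R :> R by rewrite ltr0n.
pose m : R := (2 * gamma * K%:R)^-1.
have m0 : 0 <= m by rewrite invr_ge0 !mulr_ge0// ltW.
apply: (@le_trans _ _ (\int[P]_w (m%:E * ((Z K w).2)%:E))%E).
  apply: ge0_le_integral_total => w; first exact: Gap_ge0.
  under eq_bigr do rewrite (sgda_process F Fxi r gamma lam Phi c).
  rewrite -EFinM mulrC; exact: (path_Gap Fxi r_proper r_lsc r_convex X0 Xproj F_mono
    gamma_gt0 lam_ge0 FPhi ell_gt0 F_star XC CD2 Cdiam (erefl c)).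
have mZ : measurable_fun setT (fun w => Z K w).
  apply: measurable_process => [|j _]; first exact: measurable_sgda_step.
  exact: measurable_funPT.
rewrite ge0_integralZl_EFin//.
- by rewrite [X in (_ <= X%:E)%E]mulrC EFinM lee_wpmul2l ?lee_fin//; exact: expected_state.
- by move=> w _; rewrite lee_fin; exact: state_ge0.
- by apply/measurable_EFinP; exact: (measurableT_comp measurable_snd mZ).
Qed.

End ExpectedGap.

(** * Reduction to finite suprema and comparison of constants *)

Lemma ereal_sup_image_ge0 (R : realType) (T : Type) (A : set T) (f : T -> \bar R) a :
  A a -> (forall t, (0 <= f t)%E) -> (0 <= ereal_sup [set f t | t in A])%E.
Proof.
by move=> Aa f0; apply: le_trans (f0 a) _; apply: ereal_sup_ubound; exists a.
Qed.

Theorem theoremE4 (R : realType) (d : nat)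
  (dXi dO : measure_display)
  (Xi : measurableType dXi) (D : probability Xi R)
  (Om : measurableType dO) (P : probability Om R)
  (F : 'rV[R]_d -> 'rV[R]_d) (Fxi : Xi -> 'rV[R]_d -> 'rV[R]_d)
  (r : 'rV[R]_d -> \bar R) (C : set 'rV[R]_d)
  (ell ellD gamma : R) (x0 : 'rV[R]_d) (xi : nat -> {RV P >-> Xi}) :
  let Xstar := VI_solutions F r in
  let x := sgda r Fxi gamma x0 xi in
  let sigma2 := sigma_star2 D Fxi F Xstar in
  measurable_oracle Fxi ->
  unbiased_oracle D Fxi F ->
  proper_fun r -> lower_semicontinuous r -> econvex_fun r ->
  Xstar !=set0 ->
  proj_well_defined Xstar ->
  (sigma2 < +oo)%E ->
  iid_samples D xi ->
  monotone_op F ->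
  0 < ell -> star_cocoercive Xstar F ell ->
  compact C -> convex_set (C : set (convex_lmodType 'rV[R]_d)) ->
  Xstar `<=` C ->
  expected_cocoercive D Fxi F Xstar ellD ->
  0 < gamma -> gamma <= 1 / (2 * ellD) ->
  forall K : nat, (1 <= K)%N ->
  (\int[P]_w Gap F r C (K%:R^-1 *: \sum_(1 <= k < K.+1) x k w)
   <= (3 / (2 * gamma * K%:R))%:E
        * ereal_sup [set (enorm (x0 - u)%R ^+ 2)%:E | u in C]
      + (8 * gamma * ell ^+ 2 / K%:R)%:E * diameter C ^+ 2
      + ((4 * ellD + ell) * enorm (x0 - proj Xstar x0) ^+ 2 / K%:R)%:E
      + (2 * gamma * (2 + gamma * (4 * ellD + ell)))%:E * sigma2
      + (9 * gamma)%:E * ereal_sup [set (enorm (F y) ^+ 2)%:E | y in Xstar])%E.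
Proof.
move=> X x sigma2 mFxi unb r_proper r_lsc r_convex [u0 Xu0] Xproj sigma_oo iid.
move=> F_mono ell_gt0 F_star cC _ XC coco gamma_gt0 gamma_le K K0.
have X0 : X !=set0 by exists u0.
have Cu0 := XC _ Xu0.
(* The inverse of zero is zero, so a positive gamma below 1 / (2 ellD) excludes ellD = 0 as well as
   negative values. *)
have ellD_gt0 : 0 < ellD.
  have := lt_le_trans gamma_gt0 gamma_le.
  by rewrite div1r invr_gt0 pmulr_rgt0.
have K0' : 0 < K%:R :> R by rewrite ltr0n.
set S1 := ereal_sup [set _ | _ in C]; set S2 := diameter C.
set S4 := ereal_sup [set _ | _ in X].
have S1_ge0 : (0 <= S1)%E.
  by apply: (ereal_sup_image_ge0 Cu0) => u; rewrite lee_fin sqr_ge0.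
have S2_ge0 : (0 <= S2)%E.
  by apply: (@ereal_sup_image_ge0 _ _ _ _ (u0, u0)) => // q; rewrite lee_fin enorm_ge0.
have S4_ge0 : (0 <= S4)%E.
  by apply: (ereal_sup_image_ge0 Xu0) => u; rewrite lee_fin sqr_ge0.
have sigma_ge0 : (0 <= sigma2)%E.
  by apply: (ereal_sup_image_ge0 Xu0) => u; apply: expectation_ge0 => a; exact: sqr_ge0.
have k1_gt0 : 0 < 3 / (2 * gamma * K%:R) by rewrite divr_gt0 ?mulr_gt0.
have k2_gt0 : 0 < 8 * gamma * ell ^+ 2 / K%:R.
  by rewrite divr_gt0// !mulr_gt0// exprn_gt0.
have l0 : 0 <= 4 * ellD + ell by lra.
have k3_ge0 : 0 <= (4 * ellD + ell) * enorm (x0 - proj X x0) ^+ 2 / K%:R.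
  by rewrite mulr_ge0 ?invr_ge0 ?(ltW K0')// mulr_ge0 ?sqr_ge0.
have k4_ge0 : 0 <= 2 * gamma * (2 + gamma * (4 * ellD + ell)).
  have g0 := ltW gamma_gt0.
  by apply: mulr_ge0; [exact: mulr_ge0|rewrite addr_ge0// mulr_ge0].
have k5_gt0 : 0 < 9 * gamma by rewrite mulr_gt0.
have t4_ge0 : (0 <= (2 * gamma * (2 + gamma * (4 * ellD + ell)))%:E * sigma2)%E.
  by apply: mule_ge0 => //; rewrite lee_fin.
have t5_ge0 : (0 <= (9 * gamma)%:E * S4)%E.
  by apply: mule_ge0 => //; rewrite lee_fin ltW.
have t2_ge0 : (0 <= (8 * gamma * ell ^+ 2 / K%:R)%:E * S2 ^+ 2)%E.
  by apply: mule_ge0; [rewrite lee_fin ltW|exact: expe_ge0].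
have t1_ge0 : (0 <= (3 / (2 * gamma * K%:R))%:E * S1)%E.
  by apply: mule_ge0 => //; rewrite lee_fin ltW.
have geNy (z : \bar R) : (0 <= z)%E -> z != -oo%E.
  by move=> z0; rewrite gt_eqF// (lt_le_trans ltNy0).
(* An infinite supremum has a positive coefficient and makes the right-hand side +oo, so each of the
   three may be taken finite; [sigma2] is finite by hypothesis. *)
move: S1_ge0 t1_ge0; case E1 : S1 => [D2| |//] S1_ge0 t1_ge0; last first.
  by rewrite gt0_muley ?lte_fin// !addye ?leey ?geNy ?lee_fin.
move: S2_ge0 t2_ge0; case E2 : S2 => [diam| |//] S2_ge0 t2_ge0; last first.
  rewrite [in leRHS]expeS mulyy gt0_muley ?lte_fin// addey ?geNy//.
  by rewrite !addye ?leey ?geNy ?lee_fin.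
move: S4_ge0 t5_ge0; case E4 : S4 => [Phi| |//] S4_ge0 t5_ge0; last first.
  by rewrite gt0_muley ?lte_fin// addey ?leey// geNy// !adde_ge0.
move: sigma_ge0 t4_ge0; case Es : sigma2 sigma_oo => [s| |//] // _ s_ge0 t4_ge0.
have FPhi z : X z -> dot (F z) (F z) <= Phi.
  move=> Xz; rewrite -lee_fin -E4 -enorm2E; apply: ereal_sup_ubound.
  by exists z.
have CD2 u : C u -> dot (x0 - u) (x0 - u) <= D2.
  by move=> Cu; rewrite -lee_fin -E1 -enorm2E; apply: ereal_sup_ubound; exists u.
have Cdiam u v : C u -> C v -> enorm (u - v) <= diam.
  by move=> Cu Cv; rewrite -lee_fin -E2; apply: ereal_sup_ubound; exists (u, v).
have sigma_s z : X z -> ('E_D[fun a => (enorm (Fxi a z - F z) ^+ 2)%R] <= s%:E)%E.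
  by move=> Xz; rewrite -Es; apply: ereal_sup_ubound; exists z.
apply: le_trans (expected_Gap mFxi unb r_proper r_lsc r_convex X0 Xproj iid F_mono
  ell_gt0 F_star cC XC coco gamma_gt0 ellD_gt0 gamma_le FPhi CD2 Cdiam sigma_s K0) _.
rewrite -EFin_expe -!EFinM -!EFinD lee_fin !enorm2E.
have {}S4_ge0 : 0 <= Phi by rewrite -lee_fin.
have {}s_ge0 : 0 <= s by rewrite -lee_fin.
set d0 := dot (x0 - _) _; have d0_ge0 : 0 <= d0 by exact: dot_ge0.
have K1 : K%:R^-1 <= 1 :> R by rewrite invf_le1// ler1n.
have Ki0 : 0 < K%:R^-1 :> R by rewrite invr_gt0.
(* The bound is split into five groups matching the five terms of the claim, which are then compared
   one by one. *)
have -> : (3 * D2 + 6 * gamma * ellD * d0 + 4 * gamma ^+ 2 * ell ^+ 2 * diam ^+ 2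
     + 4 * gamma ^+ 2 * Phi
     + K%:R * (2 * (3 + 6 * gamma * ellD) * gamma ^+ 2 * s + 2 * gamma ^+ 2 * Phi))
    / (2 * gamma * K%:R)
  = 3 / (2 * gamma * K%:R) * D2 + 2 * gamma * ell ^+ 2 / K%:R * diam ^+ 2
    + 3 * ellD * d0 / K%:R + (3 + 6 * gamma * ellD) * gamma * s
    + (2 * gamma * Phi / K%:R + gamma * Phi).
  by field; rewrite !gt_eqF.
apply: lerD; first apply: lerD; first apply: lerD; first apply: lerD => //.
- rewrite ler_wpM2r ?sqr_ge0// ler_wpM2r ?(ltW Ki0)// ler_wpM2r ?sqr_ge0//.
  by rewrite ler_wpM2r ?(ltW gamma_gt0)// ler_nat.
- rewrite ler_wpM2r ?(ltW Ki0)// ler_wpM2r//; lra.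
- have := mulr_ge0 (ltW gamma_gt0) s_ge0.
  have := mulr_ge0 (mulr_ge0 (sqr_ge0 gamma) s_ge0) (ltW ellD_gt0).
  have := mulr_ge0 (mulr_ge0 (sqr_ge0 gamma) s_ge0) (ltW ell_gt0).
  by move=> *; nra.
(* As 1/K <= 1, the two terms in [Phi] add up to at most 3 gamma Phi. *)
- have gP : 0 <= gamma * Phi by rewrite mulr_ge0// ltW.
  have := ler_wpM2l gP K1; rewrite mulr1 => h.
  by rewrite -!mulrA in h *; nra.
Qed.
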